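(* Assume the standing assumptions in the context, and assume in addition: (i) for every $v\in L^2(\Omega)^d$, $\|\mathcal{L}^{\mathrm{num}}_\kappa v-\mathcal{L}v\|_{L^2(\Omega)^d}\to0$ as $\kappa\searrow0$, and there is $C>0$ independent of $\kappa$ with $\|\mathcal{L}^{\mathrm{num}}_\kappa\|\le C$; (ii) there is $c^{\mathrm{num}}>0$ independent of $\kappa$ such that for all small enough $\kappa>0$ and all $\vec u\in\vec{\mathcal{V}}_\kappa$, $c^{\mathrm{num}}\|\mathcal{K}_\kappa\vec u\|^2_{L^2(\Omega)^d}\le\vec u^\top\vec B^{\mathrm{num}}\vec u$. Let $\vec u^{\mathrm{num}}_\kappa\in\vec{\mathcal{V}}_\kappa$ be the solutions of the numerical discrete systems $$(\vec u^{\mathrm{num}}_\kappa)^\top\vec B^{\mathrm{num}}\vec v=(M\vec b^{\mathrm{num}}_\kappa)^\top\vec v\quad\text{for all }\vec v\in\vec{\mathcal{V}}_\kappa,$$ and let $u\in\mathcal{V}$ be the unique solution of $B(u,v)=\int_\Omega b\cdot v\,dx$ for all $v\in\mathcal{V}$. Then $$\|\mathcal{K}_\kappa\vec u^{\mathrm{num}}_\kappa-u\|_{L^2(\Omega)^d}\to0\quad\text{as }\kappa\searrow0.$$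
   Context: Let $d\in\{2,3\}$, $\|\cdot\|$ the Euclidean norm, $\chi$ characteristic functions, $\operatorname{vol}$ Lebesgue measure. Domain. $\Omega\subset\mathbb{R}^d$ is a bounded connected (open) Lipschitz domain; $\Theta\subset\Omega$ is open, non-empty, $\operatorname{vol}(\partial\Theta)=0$. $\mathcal{V}:=\{u\in L^2(\Omega)^d:u=0\text{ a.e. on }\Theta\}$. Data. Fix $\delta>0$, $\rho(\zeta):=1/\|\zeta\|$, $\omega(\zeta):=\rho(\zeta)\chi_{[0,\delta)}(\|\zeta\|)$. The discretization parameter always satisfies $0<\kappa<\delta/\sqrt d$. For $f:\Omega\to\mathbb{R}^n$ and $F>0$, $f$ is locally $F$-Lipschitz at $x\in\Omega$ if it is $F$-Lipschitz on some neighbourhood of $x$, and a.e. locally $F$-Lipschitz if the set of $x\in\Omega$ where this fails has measure zero. $l,k:\Omega\to\mathbb{R}$ are a.e. locally $L$- resp. $K$-Lipschitz for some $L,K>0$, with $0<l_0\le l\le l_1$, $0<k_0\le k\le k_1$ on $\Omega$ for constants $l_0,l_1,k_0,k_1$. Since $l,k$ are evaluated below at points $x_i$ that need not lie in $\Omega$, they are extended beyond $\Omega$ by a constant; any constant, for example $0$, is allowed. Put $m(x):=\int_\Omega\omega(x'-x)\|x'-x\|^2dx'$, $\alpha:=l/m$, $\tau:=\frac{k d^2}{m^2}-\frac{\alpha}{m}$ on $\Omega$. Continuous form. For $u,v\in L^2(\Omega)^d$, $$B(u,v)=\int_\Omega\tau(x)\Big(\int_\Omega(u(x')-u(x))^\top(x'-x)\,\omega(x'-x)dx'\Big)\Big(\int_\Omega(v(x')-v(x))^\top(x'-x)\,\omega(x'-x)dx'\Big)dx$$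 $$+\int_\Omega\alpha(x)\int_\Omega\frac{\omega(x'-x)}{\|x'-x\|^2}(u(x')-u(x))^\top(x'-x)\,(v(x')-v(x))^\top(x'-x)\,dx'dx.$$ $\mathcal{L}:L^2(\Omega)^d\to L^2(\Omega)^d$ is the bounded self-adjoint operator with $B(u,v)=\langle u,-\mathcal{L}v\rangle_{L^2(\Omega)^d}$ for all $u,v$. Partition. For each $\kappa$, $\mathbb{R}^d$ is partitioned into half-open cubes $B_i=x_i+[-\frac\kappa2,\frac\kappa2)^d$, $x_i\in\kappa\mathbb{Z}^d$; $I^\kappa:=\{i:\operatorname{vol}(B_i\cap\Omega)>0\}$, $\Omega_i:=B_i\cap\Omega$, $V_i:=\operatorname{vol}(\Omega_i)$. All sums run over indices in $I^\kappa$. $\mathcal{K}_\kappa\vec u:=\sum_i\vec u_i\chi_{\Omega_i}$ for $\vec u\in(\mathbb{R}^d)^{|I^\kappa|}$; $(\mathcal{P}_\kappa u)_i:=\frac1{V_i}\int_{\Omega_i}u\,dx$ for $u\in L^2(\Omega)^d$; $\vec{\mathcal{V}}_\kappa:=\{\vec u\in(\mathbb{R}^d)^{|I^\kappa|}:\mathcal{K}_\kappa\vec u\in\mathcal{V}\}$. Weights. For each $\kappa$, numbers $w_{ij}$ ($i,j\in I^\kappa$) are given with: $w_{ij}=0$ if $\|x_i-x_j\|\ge\delta+\sqrt d\frac\kappa2$; $w_{ij}=1$ if $\|x_i-x_j\|\le\delta-\sqrt d\frac\kappa2$; $0\le w_{ij}\le1$; $w_{ij}=w_{ji}$. Right-hand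 side. $b\in L^2(\Omega)^d$, and $\vec b^{\mathrm{num}}_\kappa\in(\mathbb{R}^d)^{|I^\kappa|}$ satisfy $\|b-\mathcal{K}_\kappa\vec b^{\mathrm{num}}_\kappa\|_{L^2(\Omega)^d}\to0$ as $\kappa\searrow0$. $M$ is the block-diagonal matrix with blocks $V_i\,\mathrm{Id}_{\mathbb{R}^d}$. Numerical form. $m^{\mathrm{num}}(x_i):=\sum_{j\ne i}w_{ij}V_j\rho(x_j-x_i)\|x_j-x_i\|^2$, $\alpha^{\mathrm{num}}(x_i):=\frac{l(x_i)}{m^{\mathrm{num}}(x_i)}$, $\tau^{\mathrm{num}}(x_i):=\frac{k(x_i)d^2-l(x_i)}{m^{\mathrm{num}}(x_i)^2}$, and $$\mathcal{I}^{2}_{ijm}:=V_iV_jV_m\tau^{\mathrm{num}}(x_i)\rho(x_j-x_i)\rho(x_m-x_i)(x_j-x_i)(x_m-x_i)^\top w_{ij}w_{im},$$ $$\mathcal{I}^{1}_{ij}:=V_iV_j\rho(x_j-x_i)(\alpha^{\mathrm{num}}(x_i)+\alpha^{\mathrm{num}}(x_j))\frac{(x_j-x_i)(x_j-x_i)^\top}{\|x_j-x_i\|^2}w_{ij}.$$ $\vec B^{\mathrm{num}}$ (depending on $\kappa$) has the $d\times d$ blocks $$\vec B^{\mathrm{num}}_{ij}=\sum_{m\notin\{i,j\}}\mathcal{I}^2_{mij}-\sum_{m\ne i}\mathcal{I}^2_{imj}-\sum_{m\ne j}\mathcal{I}^2_{jim}-\mathcal{I}^1_{ij}\ (i\ne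 j),\qquad \vec B^{\mathrm{num}}_{ii}=\sum_{n\ne i}\sum_{m\ne i}\mathcal{I}^2_{inm}+\sum_{m\ne i}\mathcal{I}^2_{mii}+\sum_{m\ne i}\mathcal{I}^1_{im}.$$ $\mathcal{L}^{\mathrm{num}}_\kappa:L^2(\Omega)^d\to L^2(\Omega)^d$ is $[\mathcal{L}^{\mathrm{num}}_\kappa u](x):=-\frac1{V_i}\sum_j\vec B^{\mathrm{num}}_{ij}(\mathcal{P}_\kappa u)_j$ for $x\in\Omega_i$, so that $\vec u^\top\vec B^{\mathrm{num}}\vec v=\langle\mathcal{K}_\kappa\vec u,-\mathcal{L}^{\mathrm{num}}_\kappa\mathcal{K}_\kappa\vec v\rangle_{L^2(\Omega)^d}$. *)

(* Defs.v *)
From HB Require Import structures.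
From mathcomp Require Import all_boot all_order all_algebra.
From mathcomp Require Import all_classical all_reals all_analysis.

Set Implicit Arguments.
Unset Strict Implicit.
Unset Printing Implicit Defensive.

Import Order.TTheory GRing.Theory Num.Theory.
Import numFieldNormedType.Exports.

Local Open Scope classical_set_scope.
Local Open Scope ring_scope.

Section euclidean.
Context {R : realType} {d : nat}.
Implicit Types x y : 'cV[R]_d.

Definition dotv x y : R := (x^T *m y) 0 0.

(* The norm of the library on 'cV[R]_d is the sup norm. It induces the same
   topology and bounded sets, but the metric notions below need this one. *)
Definition enorm x : R := Num.sqrt (dotv x x).

Definition boundary (A : set 'cV[R]_d) : set 'cV[R]_d := closure A `\` A°.

Definition rbox x y : set 'cV[R]_d := [set z | forall c, x c 0 <= z c 0 < y c 0].

Definition rbox_vol x y : R := \prod_(c < d) Num.max 0 (y c 0 - x c 0).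

End euclidean.

Section lebesgue_outer_measure.
Context (R : realType) (d : nat).
Implicit Types A : set 'cV[R]_d.
Local Open Scope ereal_scope.

(* Lebesgue outer measure: infimum of the total volume of the coverings by at
   most countably many half-open boxes. *)
Definition leb_outer A : \bar R :=
  ereal_inf [set \esum_(k in Db.1) (rbox_vol (Db.2 k).1 (Db.2 k).2)%:E |
    Db in [set Db : set nat * ('cV[R]_d * 'cV[R]_d)^nat |
      A `<=` \bigcup_(k in Db.1) rbox (Db.2 k).1 (Db.2 k).2]].

Let rbox_vol_ge0 (x y : 'cV[R]_d) : 0 <= (rbox_vol x y)%:E.
Proof. by rewrite lee_fin; apply: prodr_ge0 => c _; rewrite le_max lexx. Qed.

Let leb_outer_ge0 A : 0 <= leb_outer A.
Proof.
by apply/le_ereal_inf_tmp => _ [Db _ <-]; apply: esum_ge0 => k _;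
  exact: rbox_vol_ge0.
Qed.

Let leb_outer0 : leb_outer set0 = 0.
Proof.
apply/eqP; rewrite eq_le leb_outer_ge0 andbT; apply: ereal_inf_lbound => /=.
by exists (set0, fun=> (0%R, 0%R)); [exact: sub0set|exact: esum_set0].
Qed.

Let le_leb_outer : {homo leb_outer : A B / A `<=` B >-> A <= B}.
Proof.
move=> A B AB; apply/ereal_inf_le_tmp => _ [Db BDb <-].
by exists Db => //; exact: subset_trans AB BDb.
Qed.

Let leb_outer_sigma_subadditive : sigma_subadditive leb_outer.
Proof.
move=> A; have [[i ioo]|] := pselect (exists i, leb_outer (A i) = +oo).
  rewrite (eseries_pinfty _ _ ioo) ?leey// => n _.
  by rewrite -ltNye (lt_le_trans _ (leb_outer_ge0 _)).
rewrite -forallNE => Aoo.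
suff add2e (e : {posnum R}) :
    leb_outer (\bigcup_n A n) <= \sum_(i <oo) leb_outer (A i) + e%:num%:E.
  by apply/lee_addgt0Pr => _/posnumP[].
rewrite (le_trans _ (epsilon_trick _ _ _))//.
pose v (b : 'cV[R]_d * 'cV[R]_d) := (rbox_vol b.1 b.2)%:E.
pose P n (Db : set nat * ('cV[R]_d * 'cV[R]_d)^nat) :=
  A n `<=` \bigcup_(k in Db.1) rbox (Db.2 k).1 (Db.2 k).2 /\
  \esum_(k in Db.1) v (Db.2 k) <=
    leb_outer (A n) + (e%:num / (2 ^ n.+1)%:R)%:E.
have [G PG] : {G & forall n, P n (G n)}.
  apply: (@choice _ _ P) => n; rewrite /P /leb_outer.
  set S := (X in ereal_inf X).
  have Sfin : ereal_inf S \is a fin_num.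
    by rewrite ge0_fin_numE ?leb_outer_ge0// ltey; apply/eqP/Aoo.
  have en1 : (0 < e%:num / (2 ^ n.+1)%:R)%R by [].
  have [_ [Db ADb <-] /ltW Dblt] := lb_ereal_inf_adherent en1 Sfin.
  by exists Db.
have /card_esym/ppcard_eqP[f] := card_nat2.
pose K := [set: nat] `*`` (fun n => (G n).1).
pose b (p : nat * nat) := (G p.1).2 p.2.
apply: (@le_trans _ _ (\esum_(p in K) v (b p))).
  apply: ereal_inf_lbound => /=; exists (f @^-1` K, b \o f).
    move=> t [n _ /((PG n).1 t)[k Dk tk]].
    by exists (f^-1%FUN (n, k)); rewrite /= ?invK ?inE.
  rewrite (@reindex_esum _ _ _ (f @^-1` K) K f)//; split => //.
  - by move=> x y _ _; apply: inj; rewrite inE.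
  - by move=> p Kp; exists (f^-1%FUN p); rewrite /= invK ?inE.
rewrite -(esum_esum (a := fun n k => v ((G n).2 k)))//; last first.
  by move=> *; exact: rbox_vol_ge0.
rewrite nneseries_esumT; last by move=> n; rewrite adde_ge0.
by apply: le_esum => n _; exact: (PG n).2.
Qed.

HB.instance Definition _ := isOuterMeasure.Build R 'cV[R]_d leb_outer
  leb_outer0 leb_outer_ge0 le_leb_outer leb_outer_sigma_subadditive.

End lebesgue_outer_measure.

Section lebesgue_measure.
Context {R : realType} {d : nat}.

Definition lebesgue_outer_measure :
  {outer_measure set 'cV[R]_d -> \bar R} := @leb_outer R d.

(* R^d with its Lebesgue (i.e. Caratheodory) measurable sets. *)
Definition lebT := caratheodory_type lebesgue_outer_measure.

Definition vol : {measure set lebT -> \bar R} :=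
  (lebesgue_outer_measure : set lebT -> \bar R).

End lebesgue_measure.

Section domain.
Context {R : realType} {d : nat}.
Implicit Types (Omega Theta : set 'cV[R]_d) (f : 'cV[R]_d -> R).

(* Near each boundary point, after a rigid motion x |-> Q (x - p), the set is
   the strict epigraph over the hyperplane orthogonal to the c-th axis of a
   Lipschitz function. *)
Definition lipschitz_boundary Omega : Prop :=
  forall p, boundary Omega p ->
  exists (r : R) (Q : 'M[R]_d) (c : 'I_d) (g : 'cV[R]_d.-1 -> R) (F : R),
  [/\ 0 < r, Q^T *m Q = 1%:M,
      forall y z, `|g y - g z| <= F * enorm (y - z) &
      forall x, enorm (x - p) < r ->
        (Omega x <-> g (row' c (Q *m (x - p))) < (Q *m (x - p)) c 0)].

Definition lipschitz_domain Omega : Prop :=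
  [/\ open Omega, connected Omega & lipschitz_boundary Omega].

Definition loc_lipschitz_at Omega (F : R) f (x : 'cV[R]_d) : Prop :=
  exists2 W, nbhs x W &
    forall y z, (Omega `&` W) y -> (Omega `&` W) z ->
      `|f y - f z| <= F * enorm (y - z).

Definition ae_loc_lipschitz Omega (F : R) f : Prop :=
  {ae vol, forall x, Omega x -> loc_lipschitz_at Omega F f x}.

End domain.

(* An element of L^2(Omega)^d is represented by a function on R^d, of which
   only the values a.e. on Omega matter. *)
Section L2.
Context {R : realType} {d : nat}.
Variable Omega : set 'cV[R]_d.
Implicit Types (u v : 'cV[R]_d -> 'cV[R]_d).
Implicit Types L : ('cV[R]_d -> 'cV[R]_d) -> ('cV[R]_d -> 'cV[R]_d).

Definition L2 : set ('cV[R]_d -> 'cV[R]_d) := [set u : 'cV[R]_d -> 'cV[R]_d |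
  (forall c, measurable_fun (Omega : set (@lebT R d))
               (fun x => u x c 0)) /\
  vol.-integrable Omega (fun x => (enorm (u x) ^+ 2)%:E)].

Definition L2dot u v : R := \int[vol]_(x in Omega) dotv (u x) (v x).

Definition L2norm u : R := Num.sqrt (\int[vol]_(x in Omega) enorm (u x) ^+ 2).

Definition L2vanishing (Theta : set 'cV[R]_d) :
    set ('cV[R]_d -> 'cV[R]_d) :=
  [set u : 'cV[R]_d -> 'cV[R]_d | L2 u /\ {ae vol, forall x, Theta x -> u x = 0}].

Definition L2bounded_by (C : R) L : Prop :=
  forall u, L2 u -> L2norm (L u) <= C * L2norm u.

Definition L2bounded_linear L : Prop :=
  [/\ forall u, L2 u -> L2 (L u),
      forall (a : R) u v, L2 u -> L2 v ->
        {ae vol, forall x, Omega x ->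
          L (fun y => a *: u y + v y) x = a *: L u x + L v x} &
      exists C : R, L2bounded_by C L].

Definition L2self_adjoint L : Prop :=
  forall u v, L2 u -> L2 v -> L2dot (L u) v = L2dot u (L v).

End L2.

Section kernel.
Context {R : realType} {d : nat}.
Implicit Type z : 'cV[R]_d.

Definition rho z : R := (enorm z)^-1.

Definition omega (delta : R) z : R :=
  rho z * \1_(`[0, delta[%classic) (enorm z).

End kernel.

Section continuous_form.
Context {R : realType} {d : nat}.
Variables (Omega : set 'cV[R]_d) (delta : R) (l k : 'cV[R]_d -> R).
Implicit Types (x : 'cV[R]_d) (u v : 'cV[R]_d -> 'cV[R]_d).

Definition wvol x : R :=
  \int[vol]_(x' in Omega) (omega delta (x' - x) * enorm (x' - x) ^+ 2).

Definition alpha x : R := l x / wvol x.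

Definition tau x : R := k x * d%:R ^+ 2 / wvol x ^+ 2 - alpha x / wvol x.

Definition dil u x : R :=
  \int[vol]_(x' in Omega) (dotv (u x' - u x) (x' - x) * omega delta (x' - x)).

Definition Bform u v : R :=
  \int[vol]_(x in Omega) (tau x * dil u x * dil v x) +
  \int[vol]_(x in Omega) (alpha x * \int[vol]_(x' in Omega)
    (omega delta (x' - x) / enorm (x' - x) ^+ 2 *
     dotv (u x' - u x) (x' - x) * dotv (v x' - v x) (x' - x))).

(* L is the operator with B(u, v) = <u, - L v>. *)
Definition represents_Bform
    (L : ('cV[R]_d -> 'cV[R]_d) -> ('cV[R]_d -> 'cV[R]_d)) : Prop :=
  [/\ L2bounded_linear Omega L, L2self_adjoint Omega L &
      forall u v, L2 Omega u -> L2 Omega v ->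
        Bform u v = L2dot Omega u (fun x => - L v x)].

End continuous_form.

(* The cubes of side kappa are indexed by Z^d. A vector indexed by I^kappa is
   represented by a family indexed by Z^d, of which only the values at the
   elements of I^kappa matter; likewise for the weights. As Omega is bounded,
   I^kappa is finite, so that the sums over it below have finite support. *)
Section discretization.
Context {R : realType} {d : nat}.
Variables (Omega : set 'cV[R]_d) (kappa : R).
Local Notation idx := 'cV[int]_d.
Implicit Types (i j : idx).

Definition center i : 'cV[R]_d := kappa *: map_mx (fun z : int => z%:~R) i.

Definition cube i : set 'cV[R]_d :=
  rbox (center i - const_mx (kappa / 2)) (center i + const_mx (kappa / 2)).

Definition cell i : set 'cV[R]_d := cube i `&` Omega.

Definition Iset : set idx := [set i | (0 < vol (cell i))%E].

Definition V i : R := fine (vol (cell i)).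

Definition Kop (u : idx -> 'cV[R]_d) (x : 'cV[R]_d) : 'cV[R]_d :=
  \sum_(i \in Iset) (\1_(cell i) x *: u i).

Definition Pop (u : 'cV[R]_d -> 'cV[R]_d) i : 'cV[R]_d :=
  \col_c ((V i)^-1 * \int[vol]_(x in cell i) u x c 0).

Definition Vvec (Theta : set 'cV[R]_d) : set (idx -> 'cV[R]_d) :=
  [set u | L2vanishing Omega Theta (Kop u)].

Definition weight_conditions (delta : R) (w : idx -> idx -> R) : Prop :=
  forall i j, Iset i -> Iset j ->
  [/\ delta + Num.sqrt d%:R * (kappa / 2) <= enorm (center i - center j) ->
        w i j = 0,
      enorm (center i - center j) <= delta - Num.sqrt d%:R * (kappa / 2) ->
        w i j = 1,
      0 <= w i j <= 1 &
      w i j = w j i].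

Section numerical_form.
Variables (l k : 'cV[R]_d -> R) (w : idx -> idx -> R).

Definition wvol_num i : R :=
  \sum_(j \in Iset `\ i)
    (w i j * V j * rho (center j - center i) *
     enorm (center j - center i) ^+ 2).

Definition alpha_num i : R := l (center i) / wvol_num i.

Definition tau_num i : R :=
  (k (center i) * d%:R ^+ 2 - l (center i)) / wvol_num i ^+ 2.

Definition I2 (i j m : idx) : 'M[R]_d :=
  (V i * V j * V m * tau_num i *
   rho (center j - center i) * rho (center m - center i) * w i j * w i m) *:
  ((center j - center i) *m (center m - center i)^T).

Definition I1 (i j : idx) : 'M[R]_d :=
  (V i * V j * rho (center j - center i) * (alpha_num i + alpha_num j) *
   w i j / enorm (center j - center i) ^+ 2) *:
  ((center j - center i) *m (center j - center i)^T).

Definition Bnum (i j : idx) : 'M[R]_d :=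
  if i == j then
    \sum_(n \in Iset `\ i) \sum_(m \in Iset `\ i) I2 i n m +
    \sum_(m \in Iset `\ i) I2 m i i +
    \sum_(m \in Iset `\ i) I1 i m
  else
    \sum_(m \in Iset `\` [set i; j]) I2 m i j -
    \sum_(m \in Iset `\ i) I2 i m j -
    \sum_(m \in Iset `\ j) I2 j i m -
    I1 i j.

(* u^T B^num v *)
Definition Bnum_form (u v : idx -> 'cV[R]_d) : R :=
  \sum_(i \in Iset) \sum_(j \in Iset) ((u i)^T *m Bnum i j *m v j) 0 0.

Definition Lnum (u : 'cV[R]_d -> 'cV[R]_d) : 'cV[R]_d -> 'cV[R]_d :=
  Kop (fun i => - (V i)^-1 *: \sum_(j \in Iset) (Bnum i j *m Pop u j)).

End numerical_form.

(* (M b)^T v *)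
Definition mass_form (b v : idx -> 'cV[R]_d) : R :=
  \sum_(i \in Iset) dotv (V i *: b i) (v i).

End discretization.

(* Main.v *)
Require Import Defs.
From HB Require Import structures.
From mathcomp Require Import all_boot all_order all_algebra.
From mathcomp Require Import all_classical all_reals all_analysis.
From mathcomp Require Import measurable_realfun.
From mathcomp Require Import ring lra zify.

(* Let K be the map sending a vector to its step function, u the continuous and
   U the discrete solution. As u vanishes on Theta and the boundary of Theta is
   null, u is an L^2 limit of step functions K v that vanish on Theta. The vector
   z = U - v is then an admissible test vector, both for the discrete problem and
   (through K z) for the continuous one. Coercivity, the symmetry of B^num and
   <b + L u, K z> = 0 give
     c |K z|^2 <= B^num(z, z) = <K b^num - b + L^num (K v) - L u, K z>,
   and the left factor tends to 0 because
   L^num (K v) - L u = L^num (K v - u) + (L^num u - L u) with L^num bounded.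
   The density of the step functions follows from the outer regularity of the
   Lebesgue measure: an open set is, up to small measure, the union of the cubes
   of a fine grid that it contains. All estimates are on squared norms, so
   that Young's inequality replaces that of Cauchy-Schwarz. *)

Import Order.TTheory GRing.Theory Num.Theory.
Import numFieldNormedType.Exports.

Local Open Scope classical_set_scope.
Local Open Scope ring_scope.

Set Implicit Arguments.
Unset Strict Implicit.
Unset Printing Implicit Defensive.

(** * Cutting half-open boxes along coordinate hyperplanes *)

Section boxes.
Context {R : realType} {d : nat}.
Implicit Types (x y z : 'cV[R]_d) (c : 'I_d) (a : R).

Lemma le_coord_norm x c : `|x c 0| <= `|x|.
Proof.
rewrite [leRHS]mx_normrE.
exact: (le_bigmax _ (fun ij : 'I_d * 'I_1 => `|x ij.1 ij.2|) (c, 0)).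
Qed.

Definition set_coord x c a : 'cV[R]_d := \col_e (if e == c then a else x e 0).

Lemma rbox_vol_ge0 x y : 0 <= rbox_vol x y.
Proof. by apply: prodr_ge0 => c _; rewrite le_max lexx. Qed.

Lemma rbox_setI_lt x y c a :
  rbox x y `&` [set z | z c 0 < a] `<=`
  rbox x (set_coord y c (Num.min (y c 0) a)).
Proof.
move=> z [/= xyz zca] e; rewrite mxE; have /andP[-> /= ze] := xyz e.
by case: eqP => // ->; rewrite lt_min zca; have /andP[_ ->] := xyz c.
Qed.

Lemma rbox_setI_ge x y c a :
  rbox x y `&` ~` [set z | z c 0 < a] `<=`
  rbox (set_coord x c (Num.max (x c 0) a)) y.
Proof.
move=> z [/= xyz /negP]; rewrite -leNgt => acz e; rewrite mxE.
have /andP[ze ->] := xyz e; rewrite andbT.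
by case: eqP => [->|//]; rewrite ge_max acz; have /andP[-> _] := xyz c.
Qed.

(** Only the factor of the coordinate [c] changes, and its edge is cut at [a]. If [a] lies outside
    the edge, one piece is degenerate and has volume 0 through the truncation [Num.max 0] in
    [rbox_vol]. *)
Lemma rbox_vol_split x y c a :
  rbox_vol x (set_coord y c (Num.min (y c 0) a)) +
  rbox_vol (set_coord x c (Num.max (x c 0) a)) y = rbox_vol x y.
Proof.
rewrite /rbox_vol (bigD1 c)//= [X in _ + X](bigD1 c)//= [RHS](bigD1 c)//=.
rewrite !mxE eqxx.
under eq_bigr => e /negbTE ec do rewrite mxE ec.
under [X in _ + _ * X]eq_bigr => e /negbTE ec do rewrite mxE ec.
rewrite -mulrDl; congr (_ * _).
rewrite /Num.max /Num.min; repeat case: ifPn; rewrite -?leNgt; lra.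
Qed.

End boxes.

(** * Lebesgue measurability and volume of boxes *)

Section lebesgue_measurability.
Context {R : realType} {d : nat}.
Implicit Types (x y : 'cV[R]_d).

(** Caratheodory's criterion: the hyperplane cuts each box of a covering of [X] in two, which yields
    coverings of both parts of [X] with the same total volume. *)
Lemma measurable_halfspace (c : 'I_d) (a : R) :
  measurable ([set z | z c 0 < a] : set (@lebT R d)).
Proof.
apply: le_caratheodory_measurable => X; apply/le_ereal_inf_tmp => _ [Db XDb <-].
under eq_esum => k _ do rewrite -(rbox_vol_split _ _ c a) EFinD.
rewrite esumD; last 2 first.
- by move=> k _; rewrite lee_fin rbox_vol_ge0.
- by move=> k _; rewrite lee_fin rbox_vol_ge0.
apply: leeD; apply: ereal_inf_lbound => /=.
- exists (Db.1, fun k => ((Db.2 k).1,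
    set_coord (Db.2 k).2 c (Num.min ((Db.2 k).2 c 0) a))) => //=.
  by move=> z [/XDb[k Dk kz] zca]; exists k => //=; exact: rbox_setI_lt.
- exists (Db.1, fun k =>
    (set_coord (Db.2 k).1 c (Num.max ((Db.2 k).1 c 0) a), (Db.2 k).2)) => //=.
  by move=> z [/XDb[k Dk kz] zca]; exists k => //=; exact: rbox_setI_ge.
Qed.

Lemma measurable_rbox x y : measurable (rbox x y : set (@lebT R d)).
Proof.
rewrite (_ : rbox x y = \bigcap_c ([set z : 'cV[R]_d | z c 0 < y c 0] `\`
                                   [set z : 'cV[R]_d | z c 0 < x c 0])).
  apply: fin_bigcap_measurable => // c _.
  by apply: measurableD; exact: measurable_halfspace.
apply/seteqP; split => [z zxy c _|z zxy c].
  have /andP[xz zy] := zxy c; split => //=.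
  by apply/negP; rewrite -leNgt.
by have [/= -> /negP] := zxy c I; rewrite -leNgt => ->.
Qed.

Lemma vol_rbox_le x y : (vol (rbox x y : set (@lebT R d)) <= (rbox_vol x y)%:E)%E.
Proof.
apply: ereal_inf_lbound => /=.
exists ([set 0%N], fun=> (x, y)) => /=; first by move=> z zxy; exists 0%N.
by rewrite esum_set1// lee_fin rbox_vol_ge0.
Qed.

Lemma bounded_vol_fin (A : set 'cV[R]_d) : bounded_set A ->
  (vol (A : set (@lebT R d)) < +oo)%E.
Proof.
(* [MA] bounds the sup norm on [A] by every number above [M]. The enclosing box has upper corner
   [r + 1], since boxes omit their upper faces. *)
move=> [M [_ MA]]; pose r := `|M| + 1.
apply: (@le_lt_trans _ _
  (vol (rbox (const_mx (- r)) (const_mx (r + 1)) : set (@lebT R d)))).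
  apply: le_outer_measure => z Az c; rewrite !mxE.
  have /(MA r)/(_ _ Az) /= : M < r by rewrite /r; have := ler_norm M; lra.
  move=> zr; have := le_trans (le_coord_norm z c) zr.
  by rewrite ler_norml; lra.
by rewrite (le_lt_trans (vol_rbox_le _ _))// ltry.
Qed.

End lebesgue_measurability.

(** * Grid cubes, open sets and outer regularity *)

Section cubes.
Context {R : realType} {d : nat}.
Implicit Types (kappa : R) (x y : 'cV[R]_d) (U : set 'cV[R]_d).

(** The shift by 1/2 is there because the cubes are centred at the grid points. *)
Definition cube_idx kappa x : 'cV[int]_d :=
  \col_c Num.floor (x c 0 / kappa + 2^-1).

(** On each coordinate, the half-open edge condition is the one that characterizes the floor. Both
    the covering and the disjointness of the cubes are read off from this equivalence. *)
Lemma cubeP kappa (i : 'cV[int]_d) x :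
  0 < kappa -> cube kappa i x <-> i = cube_idx kappa x.
Proof.
move=> k0; have coordE (z : int) (t : R) :
    (kappa * z%:~R - kappa / 2 <= t < kappa * z%:~R + kappa / 2) =
    (Num.floor (t / kappa + 2^-1) == z).
  rewrite floor_eq intrD -lerBlDr -ltrBrDr ler_pdivlMr// ltr_pdivrMr//.
  by congr (_ && _); [congr (_ <= _)|congr (_ < _)]; field.
split=> [xi|-> c]; last by rewrite !mxE coordE.
apply/colP => c; rewrite mxE; apply/esym/eqP; rewrite -coordE.
by have := xi c; rewrite !mxE.
Qed.

Lemma cube_cube_idx kappa x : 0 < kappa -> cube kappa (cube_idx kappa x) x.
Proof. by move=> k0; apply/cubeP. Qed.

(** Balls are those of the sup norm, for which two points of a half-open cube are at distance less
    than its side. *)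
Lemma cube_ball kappa i x y :
  0 < kappa -> cube kappa i x -> cube kappa i y -> ball x kappa y.
Proof.
move=> k0 xi yi; split => // c e; rewrite ord1 /ball/=.
by have := xi c; have := yi c; rewrite !mxE ltr_norml; lra.
Qed.

Lemma measurable_cube kappa i : measurable (cube kappa i : set (@lebT R d)).
Proof. exact: measurable_rbox. Qed.

(** An open set is the union of the grid cubes of sides 1/(n+1) that it contains, and these are
    countably many. *)
Lemma open_measurable_lebT U : open U -> measurable (U : set (@lebT R d)).
Proof.
move=> oU; rewrite (_ : U = \bigcup_(ni : nat * 'cV[int]_d)
    (if asbool (cube ni.1.+1%:R^-1 ni.2 `<=` U)
     then cube ni.1.+1%:R^-1 ni.2 else set0)).
  apply: countable_bigcupT_measurable => // -[n i] /=.
  by case: ifP => // _; exact: measurable_cube.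
apply/seteqP; split => [x Ux|x [[n i] _] /=]; last first.
  by case: ifPn => // /asboolP; apply.
have /nbhs_ballP[e /= e0 xeU] : nbhs x U by exact: open_nbhs_nbhs.
have [n _ /(_ _ (leqnn n)) /= ne] := near_infty_natSinv_lt (PosNum e0).
have n0 : 0 < n.+1%:R^-1 :> R by rewrite invr_gt0.
exists (n, cube_idx n.+1%:R^-1 x) => //=.
rewrite ifT; first exact: cube_cube_idx.
apply/asboolP => y yx; apply/xeU/(le_ball (ltW ne)).
by apply: cube_ball yx => //; exact: cube_cube_idx.
Qed.

(* As n grows, the collars decrease to the empty set. *)
Lemma open_collar_small U (e : R) : open U -> (vol (U : set (@lebT R d)) < +oo)%E ->
  0 < e -> exists n : nat,
    measurable (U `&` \bigcup_(y in ~` U) ball y n.+1%:R^-1 : set (@lebT R d)) /\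
    (vol (U `&` \bigcup_(y in ~` U) ball y n.+1%:R^-1 : set (@lebT R d)) < e%:E)%E.
Proof.
move=> oU Ufin e0.
pose F n : set (@lebT R d) := U `&` \bigcup_(y in ~` U) ball y n.+1%:R^-1.
have mF n : measurable (F n).
  apply: open_measurable_lebT; apply: openI => //.
  by apply: bigcup_open => y _; exact: ball_open.
have F0 : \bigcap_n F n = set0.
  rewrite -subset0 => x Fx; have [Ux _] := Fx 0%N I.
  have /nbhs_ballP[r /= r0 xrU] : nbhs x U by exact: open_nbhs_nbhs.
  have [n _ /(_ _ (leqnn n)) /= nr] := near_infty_natSinv_lt (PosNum r0).
  have [_ [y nUy /ball_sym yx]] := Fx n I.
  by apply: nUy; apply: xrU; exact: le_ball (ltW nr) _ yx.
have ndF : {homo F : n m / (n <= m)%N >-> (m <= n)%O}.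
  move=> n m nm; apply/subsetPset => x [Ux [y nUy yx]]; split => //.
  exists y => //; apply: le_ball yx.
  by rewrite lef_pV2 ?posrE// ler_nat.
have := @nonincreasing_cvg_mu _ _ _ (@vol R d) F _ mF _ ndF.
rewrite F0 measure0 => /(_ _ _)/fine_cvgP[].
- apply: le_lt_trans Ufin; apply: le_outer_measure; exact: subIsetl.
- exact: measurable0.
move=> fF /cvgr_lt/(_ _ e0) Fe.
near \oo => n; exists n; split; first exact: mF.
have Fnf : vol (F n) \is a fin_num by near: n; exact: fF.
by rewrite -(fineK Fnf) lte_fin; near: n; exact: Fe.
Unshelve. all: by end_near. Qed.

(** The volume is continuous in the lower corner. Lowering that corner puts the half-open box inside
    an open one at small cost. *)
Lemma rbox_vol_widen x y (e : R) : 0 < e ->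
  exists2 t : R, 0 < t & rbox_vol (x - const_mx t) y < rbox_vol x y + e.
Proof.
move=> e0.
have : rbox_vol (x - const_mx t) y @[t --> (0 : R)] --> rbox_vol x y.
  rewrite [X in _ --> X](_ : _ = rbox_vol (x - const_mx 0) y); last first.
    by congr rbox_vol; apply/colP => c; rewrite !mxE subr0.
  rewrite /rbox_vol; apply: cvg_big => [|c _].
    exact: mul_continuous.
  apply: (@continuous_max R R (cst 0)
    (fun t : R => y c 0 - (x - const_mx t) c 0)); first exact: cst_continuous.
  rewrite (_ : (fun t : R => _) = (fun t => y c 0 - (x c 0 - t))); last first.
    by apply/funext => t; rewrite !mxE.
  by apply: cvgB; [exact: cvg_cst|apply: cvgB; [exact: cvg_cst|exact: cvg_id]].
move=> /cvg_at_right_filter /cvgr_lt /(_ (rbox_vol x y + e)).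
rewrite ltrDl => /(_ e0) xe.
near (0 : R)^'+ => t; exists t => //.
by near: t; exact: xe.
Unshelve. all: by end_near. Qed.

(** Half of [e] pays for a nearly optimal covering by half-open boxes, the other half for enlarging
    these to open boxes. *)
Lemma vol_outer_regular (A : set (@lebT R d)) (e : R) :
  (vol A < +oo)%E -> 0 < e ->
  exists U : set 'cV[R]_d, [/\ open U, A `<=` U &
    (vol (U : set (@lebT R d)) <= vol A + e%:E)%E].
Proof.
move=> Afin e0; have e20 : 0 < e / 2 by rewrite divr_gt0.
have fA : vol A \is a fin_num by rewrite ge0_fin_numE.
have [_ [Db ADb <-] /ltW Dblt] := lb_ereal_inf_adherent e20 fA.
(* The enlargements cost a geometric series of sum e/2. *)
have e2n n : 0 < e / 2 / (2 ^ n.+1)%:R by rewrite divr_gt0// ltr0n expn_gt0.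
have /choice[t tP] : forall k, exists t : R, 0 < t /\
    rbox_vol ((Db.2 k).1 - const_mx t) (Db.2 k).2 <
    rbox_vol (Db.2 k).1 (Db.2 k).2 + e / 2 / (2 ^ k.+1)%:R.
  by move=> k; have [t] := rbox_vol_widen (Db.2 k).1 (Db.2 k).2 (e2n k); exists t.
pose b k : set 'cV[R]_d :=
  [set z | forall c, (Db.2 k).1 c 0 - t k < z c 0 < (Db.2 k).2 c 0].
exists (\bigcup_(k in Db.1) b k); split.
- apply: bigcup_open => k _; rewrite openE => z bz.
  apply: (@filter_forall _ 'I_d (fun c (w : 'cV[R]_d) =>
    (Db.2 k).1 c 0 - t k < w c 0 < (Db.2 k).2 c 0) (nbhs z)) => c.
  exact: (@coord_continuous R d 1 c 0 z _ (near_in_itvoo (bz c))).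
- move=> z /ADb[k Dk zk]; exists k => // c.
  have /andP[kz ->] := zk c; rewrite andbT.
  by rewrite (lt_le_trans _ kz)// ltrBlDr ltrDl; case: (tP k).
have bP k : b k `<=` rbox ((Db.2 k).1 - const_mx (t k)) (Db.2 k).2.
  by move=> z bz c; rewrite !mxE; have /andP[/ltW -> ->] := bz c.
(* Padding with empty sets indexes the family by all of [nat], as countable subadditivity requires;
   [v] pads the volumes by 0 accordingly. *)
pose B k := if k \in Db.1 then b k else set0.
have -> : \bigcup_(k in Db.1) b k = \bigcup_k B k.
  apply/seteqP; split => [z [k Dk zk]|z [k _]].
    by exists k => //; rewrite /B mem_set.
  by rewrite /B; case: ifPn => // /set_mem Dk zk; exists k.
apply: le_trans (outer_measure_sigma_subadditive _ _) _.
pose v k : \bar R := if k \in Db.1 then (rbox_vol (Db.2 k).1 (Db.2 k).2)%:E else 0%E.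
have v0 k : (0 <= v k)%E by rewrite /v; case: ifP => // _; rewrite lee_fin rbox_vol_ge0.
have vol_le k : (vol (B k : set (@lebT R d)) <= v k + (e / 2 / (2 ^ k.+1)%:R)%:E)%E.
  rewrite /B /v; case: ifPn => kD.
    apply: le_trans (le_outer_measure _ _ _ (bP k)) _.
    apply: le_trans (vol_rbox_le _ _) _.
    by rewrite -EFinD lee_fin ltW//; case: (tP k).
  by rewrite measure0 add0e lee_fin ltW.
apply: (@le_trans _ _ (\sum_(0 <= k <oo) (v k + (e / 2 / (2 ^ k.+1)%:R)%:E))%E).
  by apply: lee_nneseries => k *; [exact: outer_measure_ge0|exact: vol_le].
apply: le_trans (epsilon_trick _ v0 (ltW e20)) _.
rewrite [X in (_ <= _ + X%:E)%E]splitr EFinD addeA leeD2r// nneseries_esumT//.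
by rewrite /v -esum_mkcond.
Unshelve. all: by end_near. Qed.

End cubes.

(** * The Euclidean inner product *)

Section dotv_theory.
Context {R : realType} {d : nat}.
Implicit Types (x y z : 'cV[R]_d) (a : R).

Lemma dotvE x y : dotv x y = \sum_c x c 0 * y c 0.
Proof. by rewrite /dotv mxE; apply: eq_bigr => c _; rewrite mxE. Qed.

Lemma dotvC x y : dotv x y = dotv y x.
Proof. by rewrite !dotvE; apply: eq_bigr => c _; rewrite mulrC. Qed.

Lemma dotvDl x y z : dotv (x + y) z = dotv x z + dotv y z.
Proof. by rewrite /dotv linearD mulmxDl mxE. Qed.

Lemma dotvZl a x y : dotv (a *: x) y = a * dotv x y.
Proof. by rewrite /dotv linearZ/= -scalemxAl mxE. Qed.

Lemma dotv0l x : dotv 0 x = 0.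
Proof. by rewrite /dotv trmx0 mul0mx mxE. Qed.

Lemma dotvNl x y : dotv (- x) y = - dotv x y.
Proof. by rewrite -scaleN1r dotvZl mulN1r. Qed.

Lemma dotvDr x y z : dotv x (y + z) = dotv x y + dotv x z.
Proof. by rewrite dotvC dotvDl !(dotvC x). Qed.

Lemma dotvNr x y : dotv x (- y) = - dotv x y.
Proof. by rewrite dotvC dotvNl dotvC. Qed.

Lemma dotvZr a x y : dotv x (a *: y) = a * dotv x y.
Proof. by rewrite dotvC dotvZl dotvC. Qed.

Lemma dotv_ge0 x : 0 <= dotv x x.
Proof. by rewrite dotvE; apply: sumr_ge0 => c _; rewrite -expr2 sqr_ge0. Qed.

Lemma enorm_sqr x : enorm x ^+ 2 = dotv x x.
Proof. by rewrite sqr_sqrtr// dotv_ge0. Qed.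

(** Expand the square of [c *: x - y] and divide by [c]. *)
Lemma dotv_young (c : R) x y : 0 < c ->
  2 * dotv x y <= c * dotv x x + c^-1 * dotv y y.
Proof.
move=> c0; have := dotv_ge0 (c *: x - y).
rewrite dotvDl !dotvDr !dotvNl !dotvNr !dotvZl !dotvZr (dotvC y x) => h.
rewrite -(ler_pM2l c0) [leRHS]mulrDr (mulVKf (lt0r_neq0 c0)). lra.
Qed.

Lemma dotvD_le x y : dotv (x + y) (x + y) <= 2 * dotv x x + 2 * dotv y y.
Proof.
have := dotv_ge0 (x - y); rewrite !dotvDl !dotvDr !dotvNl !dotvNr (dotvC y x).
lra.
Qed.

End dotv_theory.

(** * The space L^2 of vector fields and its inner product *)

Section L2_theory.
Context {R : realType} {d : nat}.
Variable Omega : set 'cV[R]_d.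
Hypothesis mO : measurable (Omega : set (@lebT R d)).
Implicit Types (u v w : 'cV[R]_d -> 'cV[R]_d).
Local Notation L2 := (L2 Omega).
Local Notation L2dot := (L2dot Omega).

(** The measurability half of membership in [L2], isolated because it is often available before
    integrability. *)
Definition L2meas u : Prop := forall c,
  measurable_fun (Omega : set (@lebT R d)) (fun x => u x c 0).

Lemma measurable_dotv u v : L2meas u -> L2meas v ->
  measurable_fun (Omega : set (@lebT R d)) (fun x => dotv (u x) (v x)).
Proof.
move=> mu mv; under eq_fun do rewrite dotvE.
by apply: measurable_sum => c; apply: measurable_funM; [exact: mu|exact: mv].
Qed.

Lemma L2E u : L2 u <->
  L2meas u /\ vol.-integrable Omega (fun x => (dotv (u x) (u x))%:E).
Proof.
by rewrite /Defs.L2 /=; under eq_fun do rewrite enorm_sqr.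
Qed.

Lemma L2measD u v : L2meas u -> L2meas v -> L2meas (fun x => u x + v x).
Proof.
move=> mu mv c; under eq_fun do rewrite mxE.
by apply: measurable_funD; [exact: mu|exact: mv].
Qed.

Lemma L2measZ a u : L2meas u -> L2meas (fun x => a *: u x).
Proof.
move=> mu c; under eq_fun do rewrite mxE.
by apply: measurable_funM; [exact: measurable_cst|exact: mu].
Qed.

Lemma le_L2 u v w : L2meas w -> L2 u -> L2 v ->
  (forall x, Omega x ->
     dotv (w x) (w x) <= 2 * dotv (u x) (u x) + 2 * dotv (v x) (v x)) -> L2 w.
Proof.
move=> mw /L2E[mu iu] /L2E[mv iv] wuv; apply/L2E; split => //.
have : vol.-integrable Omega
    (fun x => (2%:E * (dotv (u x) (u x))%:E + 2%:E * (dotv (v x) (v x))%:E)%E).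
  by apply: integrableD => //; exact: integrableZl.
apply: le_integrable => //; first exact/measurable_EFinP/measurable_dotv.
move=> x Ox; rewrite -!EFinM -EFinD !abse_EFin lee_fin.
by rewrite ger0_norm ?dotv_ge0// (le_trans (wuv x Ox))// ler_norm.
Qed.

Lemma L2D u v : L2 u -> L2 v -> L2 (fun x => u x + v x).
Proof.
move=> Lu Lv; apply: (le_L2 _ Lu Lv) => [|x _]; last exact: dotvD_le.
by apply: L2measD; [have /L2E[] := Lu|have /L2E[] := Lv].
Qed.

Lemma L2Z a u : L2 u -> L2 (fun x => a *: u x).
Proof.
move=> /L2E[mu iu]; apply/L2E; split; first exact: L2measZ.
under eq_fun do rewrite dotvZl dotvZr mulrA EFinM.
exact: integrableZl.
Qed.

Lemma L2N u : L2 u -> L2 (fun x => - u x).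
Proof. by move=> /(L2Z (-1)); under eq_fun do rewrite scaleN1r. Qed.

Lemma L2B u v : L2 u -> L2 v -> L2 (fun x => u x - v x).
Proof. by move=> Lu Lv; exact: L2D Lu (L2N Lv). Qed.

Lemma L2_0 : L2 (fun=> 0).
Proof.
apply/L2E; split => [c|]; first exact: measurable_cst.
by under eq_fun do rewrite dotv0l; exact: integrable0.
Qed.

Lemma integrable_dotv u v : L2 u -> L2 v ->
  vol.-integrable Omega (fun x => (dotv (u x) (v x))%:E).
Proof.
move=> /L2E[mu iu] /L2E[mv iv].
have : vol.-integrable Omega
    (fun x => ((dotv (u x) (u x))%:E + (dotv (v x) (v x))%:E)%E).
  exact: integrableD.
apply: le_integrable => //; first exact/measurable_EFinP/measurable_dotv.
move=> x _; rewrite -EFinD !abse_EFin lee_fin.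
have h1 := dotv_young (u x) (v x) ltr01.
(* Young's inequality for [u] and for [- u] together bound the absolute value of the inner
   product. *)
have h2 := dotv_young (- u x) (v x) ltr01.
rewrite !dotvNl !dotvNr opprK in h2; rewrite invr1 !mul1r in h1 h2.
have := dotv_ge0 (u x); have := dotv_ge0 (v x) => a b.
by rewrite [leRHS]ger0_norm ?addr_ge0// ler_norml; lra.
Qed.

Lemma L2dotC u v : L2dot u v = L2dot v u.
Proof. by apply: eq_Rintegral => x _; exact: dotvC. Qed.

Lemma L2dotDl u v w : L2 u -> L2 v -> L2 w ->
  L2dot (fun x => u x + v x) w = L2dot u w + L2dot v w.
Proof.
move=> Lu Lv Lw; rewrite -RintegralD//; [|exact: integrable_dotv..].
by apply: eq_Rintegral => x _; exact: dotvDl.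
Qed.

Lemma L2dotZl a u v : L2 u -> L2 v ->
  L2dot (fun x => a *: u x) v = a * L2dot u v.
Proof.
move=> Lu Lv; rewrite -RintegralZl//; last exact: integrable_dotv.
by apply: eq_Rintegral => x _; exact: dotvZl.
Qed.

Lemma L2dotNl u v : L2 u -> L2 v -> L2dot (fun x => - u x) v = - L2dot u v.
Proof.
move=> Lu Lv; rewrite -mulN1r -L2dotZl//.
by apply: eq_Rintegral => x _; rewrite scaleN1r.
Qed.

Lemma L2dotBl u v w : L2 u -> L2 v -> L2 w ->
  L2dot (fun x => u x - v x) w = L2dot u w - L2dot v w.
Proof. by move=> Lu Lv Lw; rewrite (L2dotDl Lu (L2N Lv) Lw) (L2dotNl Lv Lw). Qed.

Lemma L2dot_ge0 u : 0 <= L2dot u u.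
Proof. by apply: Rintegral_ge0 => x _; exact: dotv_ge0. Qed.

Lemma L2norm_sqr u : L2norm Omega u ^+ 2 = L2dot u u.
Proof.
have E : L2dot u u = \int[vol]_(x in Omega) enorm (u x) ^+ 2.
  by apply: eq_Rintegral => x _; rewrite enorm_sqr.
by rewrite /L2norm -E sqr_sqrtr// L2dot_ge0.
Qed.

Lemma L2dotD_le u v : L2 u -> L2 v ->
  L2dot (fun x => u x + v x) (fun x => u x + v x) <=
  2 * L2dot u u + 2 * L2dot v v.
Proof.
move=> Lu Lv; have i2 w : L2 w ->
    vol.-integrable Omega (EFin \o (fun x => 2 * dotv (w x) (w x))).
  move=> Lw; have := integrable_dotv (L2Z 2 Lw) Lw.
  by under eq_fun do rewrite dotvZl.
rewrite -!RintegralZl//; [|exact: integrable_dotv..].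
rewrite -RintegralD//; [|exact: i2..].
apply: le_Rintegral => //; first by apply: integrable_dotv; exact: L2D.
- by rewrite /comp; under eq_fun do rewrite EFinD; apply: integrableD => //; exact: i2.
- by move=> x _; exact: dotvD_le.
Qed.

Lemma L2dot_young (c : R) u v : 0 < c -> L2 u -> L2 v ->
  2 * L2dot u v <= c * L2dot u u + c^-1 * L2dot v v.
Proof.
(* With s^2 = c, the square of s u - s^-1 v has the cross term -2 <u, v> and the wanted coefficients
   c and c^-1. *)
move=> c0 Lu Lv; pose s := Num.sqrt c; have s0 : 0 < s by rewrite sqrtr_gt0.
have ss : s * s = c by rewrite -expr2 sqr_sqrtr// ltW.
have := L2dot_ge0 (fun x => s *: u x - s^-1 *: v x).
have Lsu := L2Z s Lu; have Lsv := L2Z s^-1 Lv.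
rewrite (L2dotBl Lsu Lsv (L2B Lsu Lsv)) ![L2dot _ (fun x => _ - _)]L2dotC.
rewrite (L2dotBl Lsu Lsv Lsu) (L2dotBl Lsu Lsv Lsv).
rewrite (L2dotZl _ Lu Lsu) (L2dotZl _ Lu Lsv) (L2dotZl _ Lv Lsu) (L2dotZl _ Lv Lsv).
rewrite ![L2dot _ (fun x => _ *: _)]L2dotC.
rewrite (L2dotZl _ Lu Lu) (L2dotZl _ Lu Lv) (L2dotZl _ Lv Lu) (L2dotZl _ Lv Lv).
rewrite (L2dotC v u) !mulrA -!expr2.
rewrite exprVn expr2 ss mulVf ?gt_eqF// mulfV ?gt_eqF//; lra.
Qed.

End L2_theory.

(** * Step functions on the cells, their integrals and cell averages *)

Section step_functions.
Context {R : realType} {d : nat}.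
Variables (Omega : set 'cV[R]_d) (kappa : R).
Hypotheses (oO : open Omega) (bO : bounded_set Omega) (k0 : 0 < kappa).
Local Notation idx := 'cV[int]_d.
Local Notation cell := (cell Omega kappa).
Local Notation Iset := (Iset Omega kappa).
Local Notation V := (V Omega kappa).
Local Notation Kop := (Kop Omega kappa).
Local Notation Pop := (Pop Omega kappa).
Implicit Types (i j : idx) (u v : idx -> 'cV[R]_d).

Let mO : measurable (Omega : set (@lebT R d)) := open_measurable_lebT oO.

Lemma measurable_cell i : measurable (cell i : set (@lebT R d)).
Proof. by apply: measurableI => //; exact: measurable_cube. Qed.

Lemma vol_cell_fin i : vol (cell i : set (@lebT R d)) \is a fin_num.
Proof.
rewrite ge0_fin_numE//; apply: le_lt_trans (bounded_vol_fin bO).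
exact: le_outer_measure (@subIsetr _ _ _).
Qed.

Lemma V_gt0 i : Iset i -> 0 < V i.
Proof. by move=> Ii; rewrite fine_gt0// Ii ltey_eq vol_cell_fin. Qed.

Lemma cell_disjoint i j x : cell i x -> cell j x -> i = j.
Proof. by move=> [/(cubeP _ _ k0)-> _] [/(cubeP _ _ k0)-> _]. Qed.

(** A cell of positive volume contains a point of the bounded set [Omega], so the integer
    coordinates of its index lie between -N and N. Shifted by N, they are encoded by ordinals. *)
Lemma Iset_finite : finite_set Iset.
Proof.
have [M [_ MO]] := bO; pose r := `|M| + 1.
(* The margin 2 absorbs the half side between the centre of a cell and its points. *)
pose N := Num.bound (r / kappa + 2).
have rN : r / kappa + 2 < N%:R.
  by apply: archi_boundP; rewrite addr_ge0// divr_ge0 ?(ltW k0)// addr_ge0.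
apply: (sub_finite_set (B := [set map_mx (fun z : 'I_(N + N).+1 => z%:Z - N%:Z) i
    | i in [set: 'cV['I_(N + N).+1]_d]])); last first.
  exact/finite_image/finite_finset.
move=> i Ii; have [x [xi Ox]] : exists x, cell i x.
  apply: contrapT => /forallNP i0.
  have c0 : cell i = set0 by rewrite -subset0 => x /i0.
  by have : (0 < vol (cell i : set (@lebT R d)))%E := Ii; rewrite c0 measure0 ltxx.
have ci c : - N%:Z <= i c 0 <= N%:Z.
  have := xi c; rewrite !mxE.
  have /(MO r)/(_ _ Ox) /= : M < r by rewrite /r; have := ler_norm M; lra.
  move=> xr; have := le_trans (le_coord_norm x c) xr.
  move: rN; rewrite -(ltr_pM2r k0) mulrDl (divfK (lt0r_neq0 k0)) ler_norml => rN xc ic.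
  apply/andP; split; rewrite -(ler_int R) ?rmorphN/= -(ler_pM2l k0) ?mulrN; lra.
exists (map_mx (fun z : int => inord (absz (z + N%:Z))) i) => //.
apply/colP => c; rewrite !mxE; have := ci c; move: (i c 0) => z zN. rewrite inordK; lia.
Qed.

Lemma Kop_in u i x : Iset i -> cell i x -> Kop u x = u i.
Proof.
move=> Ii ix; rewrite /Defs.Kop -(fsbig_widen [set i])//=.
- by rewrite fsbig_set1 indicE mem_set// scale1r.
- by move=> _ ->.
- move=> j [Ij /= ji]; rewrite /= indicE memNset ?scale0r// => jx.
  by apply: ji; exact: cell_disjoint jx ix.
Qed.

Lemma Kop_out u x : (forall i, Iset i -> ~ cell i x) -> Kop u x = 0.
Proof.
move=> nix; rewrite /Defs.Kop fsbig1// => i Ii.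
by rewrite indicE memNset ?scale0r//; exact: nix.
Qed.

(** The index does not depend on [u], so a pointwise identity between several step functions reduces
    to one between their entries. *)
Lemma KopP x : (exists2 i, Iset i & forall u, Kop u x = u i) \/
  (forall u, Kop u x = 0).
Proof.
have [[i [Ii ix]]|nix] := pselect (exists i, Iset i /\ cell i x).
  by left; exists i => // u; exact: Kop_in.
by right => u; apply: Kop_out => i Ii ix; apply: nix; exists i.
Qed.

Lemma eq_Kop u v : (forall i, Iset i -> u i = v i) -> Kop u = Kop v.
Proof.
move=> uv; apply/funext => x; apply: eq_fsbigr => i /set_mem Ii.
by rewrite uv.
Qed.

Lemma KopD u v x : Kop (fun i => u i + v i) x = Kop u x + Kop v x.
Proof. by have [[i _ E]|E] := KopP x; rewrite !E ?addr0. Qed.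

Lemma KopZ a u x : Kop (fun i => a *: u i) x = a *: Kop u x.
Proof. by have [[i _ E]|E] := KopP x; rewrite !E ?scaler0. Qed.

Lemma KopB u v x : Kop (fun i => u i - v i) x = Kop u x - Kop v x.
Proof. by have [[i _ E]|E] := KopP x; rewrite !E ?subr0. Qed.

(** The points in question lie in countably many null cells. [F] enumerates these through the codes
    of their indices, with the empty set at all other codes. *)
Lemma negligible_null_cells :
  (@vol R d).-negligible (Omega `&` [set x | ~ Iset (cube_idx kappa x)]).
Proof.
pose F n := if unpickle n is Some i then
  if `[< Iset i >] then set0 else cell i else set0.
apply: (@negligibleS _ (@lebT R d) R _ (\bigcup_n F n)) => [x [Ox nIx]|].
  exists (pickle (cube_idx kappa x)) => //; rewrite /F pickleK ifF.
    by split => //; exact: cube_cube_idx.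
  exact/asboolP.
apply: negligible_bigcup => n; rewrite /F; case: unpickle => [i|]; last first.
  exact: negligible_set0.
case: asboolP => [_|nIi]; first exact: negligible_set0.
apply/negligibleP; first exact: measurable_cell.
apply/eqP; rewrite eq_le measure_ge0 andbT leNgt; exact/negP.
Qed.

Lemma Rintegral_indic_cst (D : set 'cV[R]_d) (a : R) :
  measurable (D : set (@lebT R d)) ->
  (@vol R d).-integrable Omega (EFin \o (fun x => \1_D x * a)) /\
  \int[vol]_(x in Omega) (\1_D x * a) = fine (vol (Omega `&` D : set (@lebT R d))) * a.
Proof.
move=> mD; split.
  apply: (measurable_bounded_integrable mO (bounded_vol_fin bO)).
    by apply: measurable_funM; [exact: measurable_indic|exact: measurable_cst].
  exists `|a|; split => [|M aM x _]; first exact: num_real.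
  apply: le_trans (ltW aM).
  by rewrite /= indicE normrM; case: (_ \in _); rewrite ?normr1 ?mul1r// normr0 mul0r.
transitivity (\int[vol]_(x in (Omega : set (@lebT R d)) `&` D) cst a x).
  rewrite Rintegral_mkcondr; apply: eq_Rintegral => x _.
  by rewrite patchE indicE; case: (_ \in _); rewrite ?mul1r ?mul0r.
by rewrite (Rintegral_cst _ (measurableI _ _ mO mD)); exact: mulrC.
Qed.

Lemma step_integral (r : seq idx) (f : idx -> R) :
  (@vol R d).-integrable Omega (EFin \o (fun x => \sum_(i <- r) \1_(cell i) x * f i)) /\
  \int[vol]_(x in Omega) (\sum_(i <- r) \1_(cell i) x * f i) = \sum_(i <- r) V i * f i.
Proof.
have h1 i : (@vol R d).-integrable Omega (EFin \o (fun x => \1_(cell i) x * f i)).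
  by have [] := Rintegral_indic_cst (f i) (measurable_cell i).
have h2 i : \int[vol]_(x in Omega) (\1_(cell i) x * f i) = V i * f i.
  have [_ ->] := Rintegral_indic_cst (f i) (measurable_cell i).
  by rewrite (setIidr (@subIsetr _ _ _)).
elim: r => [|i r [IH1 IH2]].
  under eq_Rintegral do rewrite big_nil.
  rewrite big_nil Rintegral_cst// mul0r; split => //.
  by rewrite /comp; under eq_fun do rewrite big_nil; exact: integrable0.
split.
  rewrite /comp; under eq_fun do rewrite big_cons EFinD.
  exact: (integrableD mO (h1 i) IH1).
under eq_Rintegral do rewrite big_cons.
by rewrite big_cons RintegralD// h2 IH2.
Qed.

(** An enumeration of the finite index set, which turns sums over a set into sums over a list, where
    integrals are computed by induction. *)
Definition Iseq : seq idx := finmap.enum_fset (fset_set Iset).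

Lemma fsum_Iseq (W : nmodType) (F : idx -> W) :
  \sum_(i \in Iset) F i = \sum_(i <- Iseq) F i.
Proof. exact: fsbig_finite Iset_finite. Qed.

Lemma Kop_component (u : idx -> 'cV[R]_d) c x : Kop u x c 0 =
  \sum_(i <- Iseq) \1_(cell i) x * u i c 0.
Proof.
rewrite /Defs.Kop fsum_Iseq/= summxE.
by apply: eq_bigr => i _; rewrite mxE.
Qed.

Lemma dotv_Kop u v x : dotv (Kop u x) (Kop v x) =
  \sum_(i <- Iseq) \1_(cell i) x * dotv (u i) (v i).
Proof.
rewrite -fsum_Iseq [in LHS]/Defs.Kop.
have [[i [Ii ix]]|nix] := pselect (exists i, Iset i /\ cell i x).
  rewrite -/(Kop u x) -/(Kop v x) !(Kop_in _ Ii ix) -(fsbig_widen [set i])//=.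
  - by rewrite fsbig_set1 indicE mem_set// mul1r.
  - by move=> _ ->.
  - move=> j [Ij /= ji]; rewrite /= indicE memNset ?mul0r// => jx.
    by apply: ji; exact: cell_disjoint jx ix.
have nix' i : Iset i -> ~ cell i x by move=> Ii ix; apply: nix; exists i.
rewrite -/(Kop u x) (Kop_out _ nix') dotv0l fsbig1// => i Ii.
by rewrite indicE memNset ?mul0r//; exact: nix'.
Qed.

Lemma measurable_Kop u : L2meas Omega (Kop u).
Proof.
move=> c; under eq_fun do rewrite Kop_component.
apply: measurable_sum => i; apply: measurable_funM; last exact: measurable_cst.
by apply: measurable_indic; exact: measurable_cell.
Qed.

Lemma L2_Kop u : L2 Omega (Kop u).
Proof.
apply/L2E; split; first exact: measurable_Kop.
under eq_fun do rewrite dotv_Kop.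
by have [] := step_integral Iseq (fun i => dotv (u i) (u i)).
Qed.

Lemma L2dot_Kop u v : L2dot Omega (Kop u) (Kop v) =
  \sum_(i <- Iseq) V i * dotv (u i) (v i).
Proof.
have [_ <-] := step_integral Iseq (fun i => dotv (u i) (v i)).
by apply: eq_Rintegral => x _; rewrite dotv_Kop.
Qed.

Lemma mass_formE u v : mass_form Omega kappa u v = L2dot Omega (Kop u) (Kop v).
Proof.
rewrite L2dot_Kop /mass_form fsum_Iseq.
by apply: eq_bigr => i _; rewrite dotvZl.
Qed.

Lemma Pop_Kop v i : Iset i -> Pop (Kop v) i = v i.
Proof.
move=> Ii; apply/colP => c; rewrite mxE.
have -> : \int[vol]_(x in cell i) Kop v x c 0 =
    \int[vol]_(x in cell i) cst (v i c 0) x.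
  by apply: eq_Rintegral => x /set_mem ix; rewrite (Kop_in _ Ii ix).
rewrite (Rintegral_cst _ (measurable_cell i)).
by rewrite mulrC mulfK// gt_eqF// V_gt0.
Qed.

(** A component is at most 1 + |u|^2 in absolute value, and constants are integrable on the bounded
    set [Omega]. This makes cell averages additive. *)
Lemma L2_integrable_component (u : 'cV[R]_d -> 'cV[R]_d) i c : L2 Omega u ->
  (@vol R d).-integrable (cell i) (EFin \o (fun x => u x c 0)).
Proof.
move=> /L2E[mu iu]; apply: (integrableS mO); first exact: measurable_cell.
  exact: subIsetr.
have i1 : (@vol R d).-integrable Omega (EFin \o (cst 1 : 'cV[R]_d -> R)).
  apply: (measurable_bounded_integrable mO (bounded_vol_fin bO)).
    exact: measurable_cst.
  exists 1; split => [|M M1 x _]; first exact: num_real.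
  by rewrite /= normr1 ltW.
have : (@vol R d).-integrable Omega (EFin \o (fun x => 1 + dotv (u x) (u x))).
  by rewrite /comp; under eq_fun do rewrite EFinD; exact: (integrableD mO i1 iu).
apply: (le_integrable mO); first exact/measurable_EFinP/mu.
move=> x _ /=; rewrite lee_fin.
have uc : u x c 0 * u x c 0 <= dotv (u x) (u x).
  rewrite dotvE (bigD1 c)//= lerDl; apply: sumr_ge0 => e _.
  by rewrite -expr2 sqr_ge0.
rewrite [leRHS]ger0_norm; last by rewrite addr_ge0// dotv_ge0.
by rewrite ler_norml; nra.
Qed.

Lemma PopB (u v : 'cV[R]_d -> 'cV[R]_d) i : L2 Omega u -> L2 Omega v ->
  Pop (fun x => u x - v x) i = Pop u i - Pop v i.
Proof.
move=> Lu Lv; apply/colP => c; rewrite !mxE -mulrBr; congr (_ * _).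
rewrite -RintegralB; [|exact: measurable_cell|exact: L2_integrable_component..].
by apply: eq_Rintegral => x _; rewrite !mxE.
Qed.

End step_functions.

(** * Symmetry of the discrete form and its operator *)

Lemma trmx_fsum (R : pzRingType) (m n : nat) (I : choiceType) (A : set I)
    (F : I -> 'M[R]_(m, n)) : finite_set A ->
  (\sum_(i \in A) F i)^T = \sum_(i \in A) (F i)^T.
Proof. by move=> fA; rewrite !fsbig_finite//= linear_sum. Qed.

Lemma enormN (R : realType) (d : nat) (x : 'cV[R]_d) : enorm (- x) = enorm x.
Proof. by rewrite /enorm dotvNl dotvNr opprK. Qed.

Section discrete_form.
Context {R : realType} {d : nat}.
Variables (Omega : set 'cV[R]_d) (kappa : R).
Hypotheses (oO : open Omega) (bO : bounded_set Omega) (k0 : 0 < kappa).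
Variables (l k : 'cV[R]_d -> R) (w : 'cV[int]_d -> 'cV[int]_d -> R).
Local Notation idx := 'cV[int]_d.
Local Notation Iset := (Iset Omega kappa).
Hypothesis w_sym : forall i j, Iset i -> Iset j -> w i j = w j i.
Local Notation Kop := (Kop Omega kappa).
Local Notation I2 := (I2 Omega kappa l k w).
Local Notation I1 := (I1 Omega kappa l w).
Local Notation Bnum := (Bnum Omega kappa l k w).
Local Notation Bnum_form := (Bnum_form Omega kappa l k w).
Local Notation Lnum := (Lnum Omega kappa l k w).
Local Notation Iseq := (Iseq Omega kappa).
Implicit Types (i j m : idx) (u v : idx -> 'cV[R]_d).

Lemma I2_tr i j m : (I2 i j m)^T = I2 i m j.
Proof.
rewrite /Defs.I2 linearZ/= trmx_mul trmxK; congr (_ *: _); ring.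
Qed.

Lemma I1_tr i j : (I1 i j)^T = I1 i j.
Proof. by rewrite /Defs.I1 linearZ/= trmx_mul trmxK. Qed.

Lemma I1_sym i j : Iset i -> Iset j -> I1 i j = I1 j i.
Proof.
move=> Ii Ij; rewrite /Defs.I1 /rho -(opprB (Defs.center kappa i)) enormN.
rewrite linearN/= mulmxN mulNmx opprK (w_sym Ii Ij).
by rewrite (addrC (alpha_num _ _ _ _ i)) (mulrC (V _ _ i)).
Qed.

(** Transposition exchanges the last two indices of [I2] and fixes [I1]. Hence the double sum of a
    diagonal block is only reordered, and the two negative sums of [I2] in an off-diagonal block
    change places. *)
Lemma Bnum_tr i j : Iset i -> Iset j -> (Bnum i j)^T = Bnum j i.
Proof.
move=> Ii Ij; have fI := Iset_finite bO k0.
have fD A : finite_set (Iset `\` A) by exact: finite_setD.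
rewrite /Defs.Bnum (eq_sym j i); case: ifPn => [/eqP ->|ij].
  rewrite !linearD/= !trmx_fsum//; congr (_ + _ + _).
  - under eq_fsbigr => n _ do rewrite trmx_fsum//.
    under eq_fsbigr => n _ do under eq_fsbigr => m _ do rewrite I2_tr.
    exact: exchange_fsbig.
  - by apply: eq_fsbigr => m _; rewrite I2_tr.
  - by apply: eq_fsbigr => m _; rewrite I1_tr.
rewrite !linearB/= !trmx_fsum// I1_tr (I1_sym Ii Ij) (setUC [set i]); congr (_ - _).
rewrite -!addrA (addrC (- _)); congr (_ + (- _ - _));
  by apply: eq_fsbigr => m _; exact: I2_tr.
Qed.

Lemma Bnum_formC u v : Bnum_form u v = Bnum_form v u.
Proof.
have fI := Iset_finite bO k0.
rewrite /Defs.Bnum_form exchange_fsbig//; apply: eq_fsbigr => i /set_mem Ii.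
apply: eq_fsbigr => j /set_mem Ij.
have tr00 (M : 'M[R]_1) : M 0 0 = M^T 0 0 by rewrite mxE.
by rewrite [RHS]tr00 !trmx_mul trmxK Bnum_tr// mulmxA.
Qed.

Lemma Bnum_form_Lnum u v :
  Bnum_form u v = L2dot Omega (Kop u) (fun x => - Lnum (Kop v) x).
Proof.
(* The entries of the step function -L^num (K v), since the cell averages of K v are the entries of
   [v]. The inverse volumes cancel against those of the L^2 product. *)
pose a i := (V Omega kappa i)^-1 *: \sum_(j \in Iset) (Bnum i j *m v j).
transitivity (L2dot Omega (Kop u) (Kop a)); last first.
  apply: eq_Rintegral => x _; congr dotv.
  rewrite -scaleN1r /Defs.Lnum -KopZ//; congr (_ x); apply: eq_Kop => i Ii.
  rewrite scalerA mulN1r opprK; congr (_ *: _); apply: eq_fsbigr => j /set_mem Ij.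
  by rewrite Pop_Kop.
rewrite L2dot_Kop// /Defs.Bnum_form fsum_Iseq//.
apply: eq_big_seq => i; rewrite in_fset_set; last exact: Iset_finite.
move=> /set_mem Ii.
rewrite dotvZr mulVKf ?gt_eqF//; last exact: V_gt0.
rewrite !fsum_Iseq// /dotv mulmx_sumr summxE.
by apply: eq_bigr => j _; rewrite mulmxA.
Qed.

Lemma Bnum_formBl u v z :
  Bnum_form (fun i => u i - v i) z = Bnum_form u z - Bnum_form v z.
Proof.
rewrite /Defs.Bnum_form !fsum_Iseq// -sumrB; apply: eq_bigr => i _.
rewrite !fsum_Iseq// -sumrB; apply: eq_bigr => j _.
by rewrite linearB/= !mulmxBl !mxE.
Qed.

Lemma LnumB (f g : 'cV[R]_d -> 'cV[R]_d) x : L2 Omega f -> L2 Omega g ->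
  Lnum (fun y => f y - g y) x = Lnum f x - Lnum g x.
Proof.
move=> Lf Lg; rewrite /Defs.Lnum -KopB//; congr (_ x); apply: eq_Kop => i Ii.
rewrite -scalerBr; congr (_ *: _); rewrite !fsum_Iseq// -sumrB.
by apply: eq_bigr => j _; rewrite PopB// mulmxBr.
Qed.

End discrete_form.

(** * Approximation by step functions vanishing on the cells that meet [Theta] *)

Section approximation.
Context {R : realType} {d : nat}.
Variables (Omega Theta : set 'cV[R]_d).
Hypotheses (oO : open Omega) (bO : bounded_set Omega).
Local Notation idx := 'cV[int]_d.
Implicit Types (f g : 'cV[R]_d -> 'cV[R]_d) (v : idx -> 'cV[R]_d).

Let mO : measurable (Omega : set (@lebT R d)) := open_measurable_lebT oO.

(** A pointwise condition that implies membership in [Vvec] and is plainly stable under linear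
    combinations. *)
Definition cells_avoid (kappa : R) v : Prop :=
  forall i x, cell Omega kappa i x -> Theta x -> v i = 0.

(** Approximation is asked for all small [kappa], so that several approximants can be combined on
    the same grid. The class is closed under linear combinations and L^2 limits, which reduces
    density to indicators. *)
Definition approximable f : Prop := L2 Omega f /\
  forall e : R, 0 < e -> \forall kappa \near 0^'+, exists2 v,
    cells_avoid kappa v &
    L2dot Omega (fun x => f x - Kop Omega kappa v x)
                (fun x => f x - Kop Omega kappa v x) <= e.

Lemma cells_avoid_Vvec kappa v : 0 < kappa -> Theta `<=` Omega ->
  cells_avoid kappa v -> Vvec Omega kappa Theta v.
Proof.
move=> k0 TO av; split; first exact: L2_Kop.
apply: aeW => x Tx; have [[i [Ii ix]]|nix] := pselect
    (exists i, Iset Omega kappa i /\ cell Omega kappa i x).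
  by rewrite (Kop_in k0 _ Ii ix); exact: av Tx.
by rewrite (Kop_out _)// => i Ii ix; apply: nix; exists i.
Qed.

Lemma approximableD f g : approximable f -> approximable g ->
  approximable (fun x => f x + g x).
Proof.
move=> [Lf af] [Lg ag]; split; first exact: L2D.
(* The square of a sum is at most twice the sum of the squares, and 2 (e/4) + 2 (e/4) = e. *)
move=> e e0; have e4 : 0 < e / 4 by rewrite divr_gt0.
near=> kappa.
have k0 : 0 < kappa by [].
have [v av vf] : exists2 v, cells_avoid kappa v &
    L2dot Omega (fun x => f x - Kop Omega kappa v x)
                (fun x => f x - Kop Omega kappa v x) <= e / 4.
  by near: kappa; exact: af.
have [w aw wg] : exists2 v, cells_avoid kappa v &
    L2dot Omega (fun x => g x - Kop Omega kappa v x)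
                (fun x => g x - Kop Omega kappa v x) <= e / 4.
  by near: kappa; exact: ag.
exists (fun i => v i + w i) => [i x ix Tx|].
  by rewrite (av _ _ ix Tx) (aw _ _ ix Tx) addr0.
have Lv := L2_Kop oO bO k0 v; have Lw := L2_Kop oO bO k0 w.
rewrite (_ : (fun x => _) = (fun x =>
    (f x - Kop Omega kappa v x) + (g x - Kop Omega kappa w x))); last first.
  by apply/funext => x; rewrite KopD// opprD addrACA.
apply: le_trans (L2dotD_le mO (L2B mO Lf Lv) (L2B mO Lg Lw)) _; lra.
Unshelve. all: by end_near. Qed.

Lemma approximableZ a f : approximable f -> approximable (fun x => a *: f x).
Proof.
move=> [Lf af]; split; first exact: L2Z.
(* Adding 1 keeps the divisor positive when a = 0. *)
move=> e e0; have a0 : 0 < a ^+ 2 + 1 by rewrite ltr_wpDl ?sqr_ge0.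
near=> kappa.
have k0 : 0 < kappa by [].
have [v av vf] : exists2 v, cells_avoid kappa v &
    L2dot Omega (fun x => f x - Kop Omega kappa v x)
                (fun x => f x - Kop Omega kappa v x) <= e / (a ^+ 2 + 1).
  by near: kappa; apply: af; rewrite divr_gt0.
exists (fun i => a *: v i) => [i x ix Tx|].
  by rewrite (av _ _ ix Tx) scaler0.
have Lfv := L2B mO Lf (L2_Kop oO bO k0 v).
rewrite (_ : (fun x => _) = (fun x => a *: (f x - Kop Omega kappa v x))); last first.
  by apply/funext => x; rewrite KopZ// scalerBr.
rewrite (L2dotZl mO _ Lfv (L2Z mO a Lfv)) L2dotC (L2dotZl mO _ Lfv Lfv) mulrA -expr2.
move: vf; rewrite ler_pdivlMr// mulrC; apply: le_trans.
by rewrite mulrDl mul1r lerDl L2dot_ge0.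
Unshelve. all: by end_near. Qed.

Lemma approximable0 : approximable (fun=> 0).
Proof.
split; first exact: L2_0.
move=> e e0; near=> kappa; exists (fun=> 0) => //.
rewrite (_ : (fun x => _) = (fun=> 0)); last first.
  have k0 : 0 < kappa by [].
  by apply/funext => x; have [[i _ E]|E] := KopP Omega k0 x; rewrite E subr0.
rewrite /L2dot; under eq_Rintegral do rewrite dotv0l.
by rewrite (Rintegral_cst _ mO) mul0r ltW.
Unshelve. all: by end_near. Qed.

Lemma approximable_sum (I : Type) (r : seq I) (P : pred I)
    (F : I -> 'cV[R]_d -> 'cV[R]_d) :
  (forall i, P i -> approximable (F i)) ->
  approximable (fun x => \sum_(i <- r | P i) F i x).
Proof.
move=> aF; elim: r => [|i r IH].
  by under eq_fun do rewrite big_nil; exact: approximable0.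
under eq_fun do rewrite big_cons.
by case: (boolP (P i)) => Pi; [exact: approximableD (aF i Pi) IH|exact: IH].
Qed.

Lemma approximable_lim f : L2 Omega f ->
  (forall e : R, 0 < e -> exists2 g, approximable g &
    L2dot Omega (fun x => f x - g x) (fun x => f x - g x) <= e) ->
  approximable f.
Proof.
move=> Lf fg; split => // e e0; have e4 : 0 < e / 4 by rewrite divr_gt0.
have [g [Lg ag] fge] := fg _ e4.
near=> kappa.
have k0 : 0 < kappa by [].
have [v av vg] : exists2 v, cells_avoid kappa v &
    L2dot Omega (fun x => g x - Kop Omega kappa v x)
                (fun x => g x - Kop Omega kappa v x) <= e / 4.
  by near: kappa; exact: ag.
exists v => //; have Lv := L2_Kop oO bO k0 v.
rewrite (_ : (fun x => _) =
    (fun x => (f x - g x) + (g x - Kop Omega kappa v x))); last first.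
  by apply/funext => x; rewrite subrKA.
apply: le_trans (L2dotD_le mO (L2B mO Lf Lg) (L2B mO Lg Lv)) _; lra.
Unshelve. all: by end_near. Qed.

Lemma L2_indic (A : set (@lebT R d)) (e : 'cV[R]_d) : measurable A ->
  L2 Omega (fun x => \1_A x *: e).
Proof.
move=> mA; apply/L2E; split => [c|].
  under eq_fun do rewrite mxE.
  by apply: measurable_funM; [exact: measurable_indic|exact: measurable_cst].
have [+ _] := Rintegral_indic_cst oO bO (dotv e e) mA.
congr (_.-integrable _ _); apply/funext => x /=; congr EFin.
by rewrite dotvZl dotvZr indicE; case: (_ \in _); rewrite ?mul1r ?mul0r.
Qed.

Lemma L2dot_le_vol f (D : set (@lebT R d)) (s h : R) :
  L2 Omega f -> measurable D -> 0 <= s -> (vol D <= h%:E)%E ->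
  (forall x, Omega x -> dotv (f x) (f x) <= \1_D x * s) ->
  L2dot Omega f f <= h * s.
Proof.
move=> Lf mD s0 Dh fD; have [iD ID] := Rintegral_indic_cst oO bO s mD.
apply: (@le_trans _ _ (\int[vol]_(x in Omega) (\1_D x * s))).
  exact: (le_Rintegral mO (integrable_dotv mO Lf Lf) iD fD).
rewrite ID ler_wpM2r// -lee_fin fineK; last first.
  rewrite ge0_fin_numE//; apply: le_lt_trans (bounded_vol_fin bO).
  exact: le_outer_measure (@subIsetl _ _ _).
by apply: le_trans Dh; exact: le_outer_measure (@subIsetr _ _ _).
Qed.

(** [A] is enclosed in an open set [U] of nearly the same volume that still avoids the closure of
    [Theta]. The value [a] is put on the cubes inside [U]. These miss [Theta], and for a fine grid
    they leave out only points of [U] close to its complement. *)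
Lemma approximable_indic (A : set (@lebT R d)) (a : 'cV[R]_d) : measurable A ->
  A `<=` Omega `\` closure Theta -> approximable (fun x => \1_A x *: a).
Proof.
move=> mA AO; split => [|e e0]; first exact: L2_indic.
pose W := Omega `\` closure Theta.
have oW : open W by apply: openI => //; exact/closed_openC/closed_closure.
(* [s] bounds the squared error where there is one, and is positive even if a = 0. [h] is the volume
   allowed to each of U \ A and the collar, so that (h + h) s = e. *)
pose s := dotv a a + 1; have s0 : 0 < s by rewrite ltr_wpDl ?dotv_ge0.
pose h := e / s / 2; have h0 : 0 < h by rewrite !divr_gt0.
have OD (D : set (@lebT R d)) : D `<=` Omega -> (vol D < +oo)%E.
  by move=> DO; apply: le_lt_trans (bounded_vol_fin bO); exact: le_outer_measure.
have Afin : (vol A < +oo)%E by apply: OD => x /AO[].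
have [U0 [oU0 AU0 U0A]] := vol_outer_regular Afin h0.
pose U := U0 `&` W; have oU : open U by exact: openI.
have AU : A `<=` U by move=> x Ax; split; [exact: AU0|exact: AO].
have UO : U `<=` Omega by move=> x [_ []].
have mU := open_measurable_lebT oU.
have [n [mC Ch]] := open_collar_small oU (OD _ UO) h0.
set C := (X in vol X) in mC Ch.
have UAh : (vol ((U : set (@lebT R d)) `\` A) <= h%:E)%E.
  rewrite (measureD mU mA (OD _ UO)) (setIidr AU) leeBlDr; last first.
    by rewrite ge0_fin_numE.
  by rewrite addeC; apply: le_trans U0A; exact: le_outer_measure (@subIsetl _ _ _).
near=> kappa.
have k0 : 0 < kappa by [].
have kn : kappa < n.+1%:R^-1 by near: kappa; apply: nbhs_right_lt; rewrite invr_gt0.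
(* This step function differs from \1_A a only on U `\` A, on the collar and on
   the null cells. *)
exists (fun i => if `[< cube kappa i `<=` U >] then a else 0).
  move=> i x [ix _] Tx; case: asboolP => // iU.
  by have [_ [_ []]] := iU x ix; exact: subset_closure.
have [M [mM M0 NM]] := negligible_null_cells oO k0.
pose D := ((U : set (@lebT R d)) `\` A) `|` C `|` M.
have mUA := measurableD mU mA.
have mD : measurable D by do 2 apply: measurableU => //.
have Dh : (vol D <= (h + h)%:E)%E.
  have vM0 : vol M = 0%E by exact: M0.
  have : (vol D <= vol (((U : set (@lebT R d)) `\` A) `|` C) + vol M)%E.
    by apply: measureU2 => //; exact: measurableU.
  rewrite vM0 adde0 => /le_trans; apply; apply: le_trans (measureU2 _ mUA mC) _.
  by rewrite EFinD; exact: leeD UAh (ltW Ch).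
have -> : e = (h + h) * s by rewrite /h -splitr divfK// gt_eqF.
apply: (L2dot_le_vol _ mD (ltW s0) Dh) => [|x Ox].
  exact: (L2B mO (L2_indic a mA) (L2_Kop oO bO k0 _)).
(* On [D] the difference is 0, a or -a; off [D] it vanishes. *)
have [xD|xD] := pselect (D x).
  rewrite [\1_D x]indicE mem_set// mul1r.
  have aas : dotv a a <= s by rewrite lerDl.
  have [[i _ ->]|->] := KopP Omega k0 x; rewrite indicE;
    case: (x \in A); try case: asboolP => _;
    rewrite ?scale1r ?scale0r ?subr0 ?subrr ?sub0r ?dotvNl ?dotvNr ?opprK
            ?dotv0l ?(ltW s0)//.
rewrite [\1_D x]indicE memNset// mul0r.
have xI : Iset Omega kappa (cube_idx kappa x).
  apply: contrapT => nxI; apply: xD; right; apply: NM; split => //.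
have xc : cube kappa (cube_idx kappa x) x by exact: cube_cube_idx.
rewrite (Kop_in k0 _ xI (conj xc Ox)).
case: asboolP => [cU|ncU]; rewrite indicE.
  rewrite mem_set ?scale1r ?subrr ?dotv0l//.
  apply: contrapT => nAx; apply: xD; left; left; split => //; exact: cU.
rewrite memNset ?scale0r ?subrr ?dotv0l// => Ax.
(* A point [y] of the cube of [x] outside [U] would be within 1/(n+1) of [x], which would put [x] in
   the collar. *)
apply: ncU => y yc; apply: contrapT => nUy; apply: xD; left; right.
split; first exact: AU.
exists y => //; apply: (le_ball (ltW kn)); exact: (cube_ball k0 yc xc).
Unshelve. all: by end_near. Qed.

End approximation.

(** * From indicators to all fields in L^2 that vanish on [Theta] *)

Import HBNNSimple.

Section approximation_L2.
Context {R : realType} {d : nat}.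
Variables (Omega Theta : set 'cV[R]_d).
Hypotheses (oO : open Omega) (bO : bounded_set Omega).
Local Notation idx := 'cV[int]_d.
Implicit Types (f g : 'cV[R]_d -> 'cV[R]_d) (v : idx -> 'cV[R]_d).

Let mO : measurable (Omega : set (@lebT R d)) := open_measurable_lebT oO.

Local Notation W := (Omega `\` closure Theta).
Local Notation approximable := (approximable Omega Theta).

Let mW : measurable (W : set (@lebT R d)).
Proof.
by apply/open_measurable_lebT/openI => //; exact/closed_openC/closed_closure.
Qed.

(** A simple function is a finite combination of the indicators of its level sets, here cut down to
    [W]. *)
Lemma approximable_nnsfun (h : {nnsfun (@lebT R d) >-> R}) (a : 'cV[R]_d) :
  approximable (fun x => (h x * \1_W x) *: a).
Proof.
rewrite (_ : (fun x => _) = (fun x =>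
    \sum_(y <- finmap.enum_fset (fset_set (range h)))
      y *: (\1_((h @^-1` [set y]) `&` W) x *: a))).
  apply: (approximable_sum oO bO) => y _; apply: (approximableZ oO bO).
  by apply: (approximable_indic oO bO) => [|x []//]; exact: measurableI.
apply/funext => x; rewrite {1}fimfunE fsbig_finite//= mulr_suml scaler_suml.
by apply: eq_bigr => y _; rewrite scalerA -mulrA indicI.
Qed.

(** Simple functions between 0 and [f] converge to [f] pointwise on [Omega]. By dominated
    convergence they also do so in L^2, with |a|^2 f^2 dominating the squared errors. *)
Lemma approximable_ge0 (f : 'cV[R]_d -> R) (a : 'cV[R]_d) :
  measurable_fun (Omega : set (@lebT R d)) f ->
  (@vol R d).-integrable Omega (EFin \o (fun x => f x ^+ 2)) ->
  (forall x, 0 <= f x) -> approximable (fun x => (f x * \1_W x) *: a).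
Proof.
move=> mf if2 f0.
have m1 : measurable_fun (Omega : set (@lebT R d)) (\1_W : @lebT R d -> R).
  exact: measurable_indic.
have mg (g : 'cV[R]_d -> R) : measurable_fun (Omega : set (@lebT R d)) g ->
    L2meas Omega (fun x => (g x * \1_W x) *: a).
  move=> mg c; under eq_fun do rewrite mxE.
  by apply: measurable_funM; [exact: measurable_funM|exact: measurable_cst].
have dotga (g : 'cV[R]_d -> R) x :
    dotv ((g x * \1_W x) *: a) ((g x * \1_W x) *: a) <= dotv a a * g x ^+ 2.
  rewrite dotvZl dotvZr indicE expr2.
  have := dotv_ge0 a; have := sqr_ge0 (g x).
  by case: (_ \in _); rewrite ?mulr1 ?mulr0 ?mul0r expr2 => *; nra.
have if2a : (@vol R d).-integrable Omega (EFin \o (fun x => dotv a a * f x ^+ 2)).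
  by rewrite /comp; under eq_fun do rewrite EFinM; exact: integrableZl.
have Lg (g : 'cV[R]_d -> R) : measurable_fun (Omega : set (@lebT R d)) g ->
    (forall x, Omega x -> g x ^+ 2 <= f x ^+ 2) ->
    L2 Omega (fun x => (g x * \1_W x) *: a).
  move=> mg0 gf; apply/L2E; split; first exact: mg.
  apply: (le_integrable mO _ _ if2a).
    exact/measurable_EFinP/(measurable_dotv (mg g mg0) (mg g mg0)).
  move=> x Ox /=; rewrite lee_fin !ger0_norm ?dotv_ge0//; last first.
    by rewrite mulr_ge0 ?dotv_ge0// sqr_ge0.
  by apply: le_trans (dotga g x) _; rewrite ler_wpM2l ?dotv_ge0// gf.
apply: (approximable_lim oO bO (Lg f mf (fun x _ => lexx _))).
move=> e e0.
have mEf : measurable_fun (Omega : set (@lebT R d)) (EFin \o f).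
  exact/measurable_EFinP.
have f0e y : Omega y -> (0%R <= (EFin \o f) y)%E by move=> _; rewrite lee_fin.
pose h n := nnsfun_approx mO mEf n.
have hf n x : Omega x -> 0 <= h n x <= f x.
  move=> Ox; rewrite /h nnsfun_approxE; apply/andP; split.
    by rewrite -nnsfun_approxE.
  by rewrite -lee_fin; exact: (@le_approx _ (@lebT R d) R Omega (EFin \o f) n x f0e Ox).
have mh n : measurable_fun (Omega : set (@lebT R d)) (h n).
  exact: measurable_funTS.
pose G n x := ((f x - h n x) * \1_W x) *: a.
have fhf n x : Omega x -> (f x - h n x) ^+ 2 <= f x ^+ 2.
  by move=> /(hf n) /andP[? ?]; rewrite ler_sqr ?nnegrE ?f0; lra.
have Lh n : L2 Omega (fun x => (h n x * \1_W x) *: a).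
  apply: Lg => [|x Ox]; first exact: mh.
  by have /andP[? ?] := hf n x Ox; rewrite ler_sqr ?nnegrE ?f0.
have GE n : G n = (fun x => (f x * \1_W x) *: a - (h n x * \1_W x) *: a).
  by apply/funext => x; rewrite /G mulrBl scalerBl.
have LG n : L2 Omega (G n).
  by rewrite GE; exact: (L2B mO (Lg f mf (fun x _ => lexx _)) (Lh n)).
have cvgG x : Omega x -> (fun n => (dotv (G n x) (G n x))%:E) @ \oo --> 0%E.
  move=> Ox.
  have hx : h n x @[n --> \oo] --> f x.
    by have /fine_cvgP[_] := cvg_nnsfun_approx mO mEf f0e Ox.
  rewrite (_ : (fun n => _) =
      EFin \o (fun n => (f x - h n x) ^+ 2 * (\1_W x ^+ 2 * dotv a a))); last first.
    by apply/funext => n; rewrite /= dotvZl dotvZr; congr EFin; ring.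
  rewrite (_ : 0%E = ((f x - f x) ^+ 2 * (\1_W x ^+ 2 * dotv a a))%:E); last first.
    by rewrite subrr expr0n mul0r.
  apply: cvg_EFin; first exact: nearW.
  have fhx : f x - h n x @[n --> \oo] --> f x - f x by apply: cvgB hx; exact: cvg_cst.
  by apply: cvgMr_tmp; rewrite !expr2; exact: (cvgM fhx fhx).

have [] := @dominated_convergence _ _ _ (@vol R d) Omega mO
  (fun n x => (dotv (G n x) (G n x))%:E) (cst 0%E)
  (EFin \o (fun x => dotv a a * f x ^+ 2)) _ (measurable_cst _) _ if2a _.
- move=> n; apply/measurable_EFinP.
  have /L2E[mGn _] := LG n; exact: (measurable_dotv mGn mGn).
- exact: aeW.
- apply: aeW => x n Ox; rewrite abse_EFin lee_fin ger0_norm ?dotv_ge0//.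
  apply: le_trans (dotga (fun x => f x - h n x) x) _.
  by rewrite ler_wpM2l ?dotv_ge0// fhf.
move=> _ _; rewrite integral0 => /fine_cvgP[_ /cvgr_lt/(_ e e0)].
move=> [n _ /(_ n (leqnn n)) Gn].
exists (fun x => (h n x * \1_W x) *: a); first exact: approximable_nnsfun.
by rewrite -GE; exact: ltW.
Qed.

Lemma ae_L2dot0 f : L2meas Omega f ->
  {ae @vol R d, forall x, Omega x -> f x = 0} -> L2dot Omega f f = 0.
Proof.
move=> mf f0; rewrite /L2dot /Rintegral (ae_eq_integral (cst 0%E))//.
- by rewrite integral0.
- exact/measurable_EFinP/(measurable_dotv mf mf).
- case: f0 => N [mN N0 fN]; exists N; split => // x /= nfx; apply: fN => /= fx.
  by apply: nfx => Ox; rewrite fx// dotv0l.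
Qed.

(** Positive and negative parts of the coordinates handle the restriction of [f] to [W]. This
    restriction equals [f] a.e. on [Omega], because [f] vanishes a.e. on [Theta] and the rest of its
    closure is null. *)
Lemma approximable_L2vanishing f : open Theta -> vol (boundary Theta) = 0%E ->
  L2vanishing Omega Theta f -> approximable f.
Proof.
move=> oT bT0 [Lf f0]; have /L2E[mf if2] := Lf.
have mcoord c : measurable_fun (Omega : set (@lebT R d)) (fun x => f x c 0) := mf c.
pose fp c := funrpos (fun x => f x c 0); pose fn c := funrneg (fun x => f x c 0).
have intg (g : 'cV[R]_d -> R) c : measurable_fun (Omega : set (@lebT R d)) g ->
    (forall x, 0 <= g x <= `|f x c 0|) ->
    (@vol R d).-integrable Omega (EFin \o (fun x => g x ^+ 2)).
  move=> mg gf; apply: (le_integrable mO _ _ if2).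
    by apply/measurable_EFinP; exact: measurable_funX.
  move=> x _; rewrite /= lee_fin !ger0_norm ?dotv_ge0 ?sqr_ge0//.
  apply: (@le_trans _ _ (`|f x c 0| ^+ 2)).
    by have /andP[? ?] := gf x; rewrite ler_sqr ?nnegrE.
  rewrite real_normK ?num_real// dotvE (bigD1 c)//= -expr2 lerDl.
  by apply: sumr_ge0 => e _; rewrite -expr2 sqr_ge0.
have afp c : approximable (fun x => (fp c x * \1_W x) *: delta_mx c 0).
  have mfp : measurable_fun (Omega : set (@lebT R d)) (fp c).
    exact: measurable_funrpos.
  apply: (approximable_ge0 _ mfp) => [|x]; last exact: funrpos_ge0.
  apply: (intg _ c mfp) => x; rewrite funrpos_ge0/= /fp /funrpos.
  by rewrite ge_max normr_ge0 ler_norm.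
have afn c : approximable (fun x => (fn c x * \1_W x) *: delta_mx c 0).
  have mfn : measurable_fun (Omega : set (@lebT R d)) (fn c).
    exact: measurable_funrneg.
  apply: (approximable_ge0 _ mfn) => [|x]; last exact: funrneg_ge0.
  apply: (intg _ c mfn) => x; rewrite funrneg_ge0/= /fn /funrneg.
  by rewrite ge_max normr_ge0 ler_normr lexx orbT.
have aW : approximable (fun x => \1_W x *: f x).
  rewrite (_ : (fun x => _) = (fun x => \sum_c
      ((fp c x * \1_W x) *: delta_mx c 0 +
       (-1) *: ((fn c x * \1_W x) *: delta_mx c 0)))); last first.
    apply/funext => x; apply/colP => c; rewrite summxE (bigD1 c)//= big1.
      rewrite !mxE !eqxx /= !mulr1 addr0 mulN1r -mulrBl mulrC; congr (_ * _).
      rewrite /fp /fn /funrpos /funrneg /Num.max.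
      by case: ltP => ?; case: ltP => ?; lra.
    move=> e ec; rewrite !mxE (eq_sym c e) (negbTE ec) /=.
    by rewrite !mulr0 addr0.
  apply: (approximable_sum oO bO) => c _.
  exact: (approximableD oO bO (afp c) (approximableZ oO bO _ (afn c))).
have [LW _] := aW.
apply: (approximable_lim oO bO Lf) => e e0; exists (fun x => \1_W x *: f x) => //.
have /L2E[mfW _] := L2B mO Lf LW.
suff fW : {ae @vol R d, forall x, Omega x -> f x - \1_W x *: f x = 0}.
  by rewrite (ae_L2dot0 mfW fW) ltW.
have : (@vol R d).-negligible (boundary Theta).
  apply/negligibleP => //.
  apply: measurableD; last exact/open_measurable_lebT/open_interior.
  rewrite -[closure _]setCK; apply: measurableC.
  exact/open_measurable_lebT/closed_openC/closed_closure.
move=> bTn; apply: (@negligibleS _ (@lebT R d) R _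
  (boundary Theta `|` ~` [set x | Theta x -> f x = 0])); last exact: negligibleU.
move=> x /= nx; apply: contrapT => /not_orP[nb /contrapT Tf]; apply: nx => Ox.
have [cx|ncx] := pselect (closure Theta x); last first.
  by rewrite indicE mem_set// scale1r subrr.
have Tx : Theta x.
  by apply: contrapT => nTx; apply: nb; split => // /interior_subset.
by rewrite Tf// scaler0 subrr.
Qed.

Lemma approximation_L2vanishing f (e : R) : open Theta -> Theta `<=` Omega ->
  vol (boundary Theta) = 0%E -> L2vanishing Omega Theta f -> 0 < e ->
  \forall kappa \near 0^'+, exists2 v, Vvec Omega kappa Theta v &
    L2dot Omega (fun x => f x - Kop Omega kappa v x)
                (fun x => f x - Kop Omega kappa v x) <= e.
Proof.
move=> oT TO bT0 fT e0; have [_ /(_ _ e0) af] := approximable_L2vanishing oT bT0 fT.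
near=> kappa.
have [v av vf] : exists2 v, cells_avoid Omega Theta kappa v &
    L2dot Omega (fun x => f x - Kop Omega kappa v x)
                (fun x => f x - Kop Omega kappa v x) <= e by near: kappa.
have k0 : 0 < kappa by [].
by exists v; [exact: (cells_avoid_Vvec oO bO k0 TO av)|exact: vf].
Unshelve. all: by end_near. Qed.

End approximation_L2.

(** * Convergence of the discrete solutions *)

Unset Implicit Arguments.

Theorem theorem3p8 (R : realType) (d : nat) (hd : d = 2%N \/ d = 3%N)
  (* domain *)
  (Omega Theta : set 'cV[R]_d)
  (Omega_bounded : bounded_set Omega)
  (Omega_domain : lipschitz_domain Omega)
  (Theta_open : open Theta) (Theta_sub : Theta `<=` Omega)
  (Theta_nonempty : Theta !=set0)
  (Theta_boundary : vol (boundary Theta) = 0%E)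
  (* data *)
  (delta : R) (delta_gt0 : 0 < delta)
  (l k : 'cV[R]_d -> R) (lL kL l0 l1 k0 k1 lext kext : R)
  (lL_gt0 : 0 < lL) (l_lipschitz : ae_loc_lipschitz Omega lL l)
  (kL_gt0 : 0 < kL) (k_lipschitz : ae_loc_lipschitz Omega kL k)
  (l0_gt0 : 0 < l0) (l_bounds : forall x, Omega x -> l0 <= l x <= l1)
  (k0_gt0 : 0 < k0) (k_bounds : forall x, Omega x -> k0 <= k x <= k1)
  (l_extension : forall x, ~ Omega x -> l x = lext)
  (k_extension : forall x, ~ Omega x -> k x = kext)
  (* the operator of the continuous form *)
  (L : ('cV[R]_d -> 'cV[R]_d) -> ('cV[R]_d -> 'cV[R]_d))
  (L_represents : represents_Bform Omega delta l k L)
  (* weights, for each kappa *)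
  (w : R -> 'cV[int]_d -> 'cV[int]_d -> R)
  (w_conditions : forall kappa, 0 < kappa < delta / Num.sqrt d%:R ->
    weight_conditions Omega kappa delta (w kappa))
  (* right-hand side *)
  (b : 'cV[R]_d -> 'cV[R]_d) (b_L2 : L2 Omega b)
  (bnum : R -> 'cV[int]_d -> 'cV[R]_d)
  (bnum_cvg : L2norm Omega (fun x => b x - Kop Omega kappa (bnum kappa) x)
    @[kappa --> 0^'+] --> 0)
  (* (i) *)
  (Lnum_cvg : forall v, L2 Omega v ->
    L2norm Omega (fun x => Lnum Omega kappa l k (w kappa) v x - L v x)
      @[kappa --> 0^'+] --> 0)
  (Lnum_bounded : exists2 C : R, 0 < C &
    forall kappa, 0 < kappa < delta / Num.sqrt d%:R ->
      L2bounded_by Omega C (Lnum Omega kappa l k (w kappa)))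
  (* (ii) *)
  (Bnum_coercive : exists2 c : R, 0 < c &
    \forall kappa \near 0^'+, forall u, Vvec Omega kappa Theta u ->
      c * L2norm Omega (Kop Omega kappa u) ^+ 2 <=
        Bnum_form Omega kappa l k (w kappa) u u)
  (* discrete solutions *)
  (unum : R -> 'cV[int]_d -> 'cV[R]_d)
  (unum_solution : \forall kappa \near 0^'+,
    Vvec Omega kappa Theta (unum kappa) /\
    forall v, Vvec Omega kappa Theta v ->
      Bnum_form Omega kappa l k (w kappa) (unum kappa) v =
        mass_form Omega kappa (bnum kappa) v)
  (* continuous solution *)
  (u : 'cV[R]_d -> 'cV[R]_d) (u_L2vanishing : L2vanishing Omega Theta u)
  (u_solution : forall v, L2vanishing Omega Theta v ->
    Bform Omega delta l k u v = L2dot Omega b v) :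
  L2norm Omega (fun x => Kop Omega kappa (unum kappa) x - u x)
    @[kappa --> 0^'+] --> 0.
Proof.
have [oO _ _] := Omega_domain; have mO := open_measurable_lebT oO.
have [C C0 LC] := Lnum_bounded; have [c c0 cB] := Bnum_coercive.
have [[LL _ _] L_sa LB] := L_represents.
have [Lu _] := u_L2vanishing; have LLu := LL _ Lu.
(* [Q] is the factor in the final estimate |K U - u|^2 <= Q h, where [h] bounds the squared norms of
   u - K v, b - K b^num and L^num u - L u. Hence the choice h = e^2 / Q below. *)
pose Q := 2 * ((6 + 4 * C ^+ 2) / c ^+ 2) + 2.
have Q0 : 0 < Q.
  by rewrite ltr_wpDl// mulr_ge0// divr_ge0 ?sqr_ge0// addr_ge0// mulr_ge0// sqr_ge0.
apply/cvgr0Pnorm_le => e e0.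
pose h := e ^+ 2 / Q; have h0 : 0 < h by rewrite divr_gt0// exprn_gt0.
have near_sq (F : R -> 'cV[R]_d -> 'cV[R]_d) :
    L2norm Omega (F kappa) @[kappa --> 0^'+] --> 0 ->
    \forall kappa \near 0^'+, L2dot Omega (F kappa) (F kappa) <= h.
  move=> /cvgr0Pnorm_le/(_ (Num.sqrt h)); rewrite sqrtr_gt0 => /(_ h0).
  apply: filterS => kappa; rewrite ger0_norm ?sqrtr_ge0// => Fh.
  rewrite -L2norm_sqr// -(sqr_sqrtr (ltW h0)) ler_sqr ?nnegrE ?sqrtr_ge0//.
have r1h := near_sq _ bnum_cvg; have r3h := near_sq _ (Lnum_cvg _ Lu).
have vh := approximation_L2vanishing oO Omega_bounded Theta_open Theta_sub
  Theta_boundary u_L2vanishing h0.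
near=> kappa.
have kp : 0 < kappa by [].
have kd : 0 < kappa < delta / Num.sqrt d%:R.
  rewrite kp/=; near: kappa; apply: nbhs_right_lt.
  by rewrite divr_gt0// sqrtr_gt0 ltr0n; case: hd => ->.
have [v vV vle] : exists2 v, Vvec Omega kappa Theta v &
    L2dot Omega (fun x => u x - Kop Omega kappa v x)
                (fun x => u x - Kop Omega kappa v x) <= h by near: kappa.
have r1le : L2dot Omega (fun x => b x - Kop Omega kappa (bnum kappa) x)
    (fun x => b x - Kop Omega kappa (bnum kappa) x) <= h.
  by near: kappa; exact: r1h.
have r3le : L2dot Omega (fun x => Lnum Omega kappa l k (w kappa) u x - L u x)
    (fun x => Lnum Omega kappa l k (w kappa) u x - L u x) <= h.
  by near: kappa; exact: r3h.
have cBk : forall u, Vvec Omega kappa Theta u ->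
      c * L2norm Omega (Kop Omega kappa u) ^+ 2 <=
        Bnum_form Omega kappa l k (w kappa) u u by near: kappa.
have [uV uB] : Vvec Omega kappa Theta (unum kappa) /\
    forall v, Vvec Omega kappa Theta v ->
      Bnum_form Omega kappa l k (w kappa) (unum kappa) v =
        mass_form Omega kappa (bnum kappa) v by near: kappa.
have w_sym i j : Iset Omega kappa i -> Iset Omega kappa j ->
    w kappa i j = w kappa j i.
  by move=> Ii Ij; have [] := w_conditions _ kd _ _ Ii Ij.
pose K := Kop Omega kappa; pose Ln := Lnum Omega kappa l k (w kappa).
have LK z : L2 Omega (K z) := L2_Kop oO Omega_bounded kp z.
have LLn f : L2 Omega (Ln f) := L2_Kop oO Omega_bounded kp _.
pose z i := unum kappa i - v i; have LKz := LK z.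
have Kz x : K z x = K (unum kappa) x - K v x := KopB Omega kp (unum kappa) v x.
have zV : Vvec Omega kappa Theta z.
  have [_ u0] := uV; have [_ v0] := vV; split => //.
  apply: (@negligibleS _ (@lebT R d) R _
    (~` [set x | Theta x -> K (unum kappa) x = 0] `|`
     ~` [set x | Theta x -> K v x = 0])); last exact: negligibleU.
  move=> x /= nx; apply: contrapT => /not_orP[/contrapT ux /contrapT vx].
  apply: nx => Tx.
  by rewrite [LHS]Kz [K _ x]ux// [K v x]vx// subrr.
have LuKv := L2B mO Lu (LK v).
(* By linearity of L^num, r3 - r2 = L^num (K v) - L u, so [g] is the total residual tested against K
   z. *)
pose r1 x := b x - K (bnum kappa) x; pose r2 := Ln (fun x => u x - K v x).
pose r3 x := Ln u x - L u x; pose g x := (r3 x - r2 x) - r1 x.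
have Lr1 : L2 Omega r1 := L2B mO b_L2 (LK _).
have Lr3 : L2 Omega r3 := L2B mO (LLn u) LLu.
have Lr2 : L2 Omega r2 := LLn _.
have Lr32 := L2B mO Lr3 Lr2.
have Lg : L2 Omega g := L2B mO Lr32 Lr1.
have r2h : L2dot Omega r2 r2 <= C ^+ 2 * h.
  rewrite -L2norm_sqr.
  apply: (@le_trans _ _ ((C * L2norm Omega (fun x => u x - K v x)) ^+ 2)).
    rewrite ler_sqr ?nnegrE ?sqrtr_ge0//; first exact: LC kd _ LuKv.
    by rewrite mulr_ge0 ?sqrtr_ge0// ltW.
  by rewrite exprMn ler_wpM2l ?sqr_ge0// L2norm_sqr.
have sqN (f : 'cV[R]_d -> 'cV[R]_d) :
    L2dot Omega (fun x => - f x) (fun x => - f x) = L2dot Omega f f.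
  by apply: eq_Rintegral => x _; rewrite dotvNl dotvNr opprK.
(* Splitting off [r1] and then [r2] gives 2 (2 h + 2 C^2 h) + 2 h. *)
have gh : L2dot Omega g g <= (6 + 4 * C ^+ 2) * h.
  have g1 := L2dotD_le mO Lr32 (L2N mO Lr1).
  have g2 := L2dotD_le mO Lr3 (L2N mO Lr2).
  rewrite sqN in g1; rewrite sqN in g2; apply: le_trans g1 _.
  have r1le' : L2dot Omega r1 r1 <= h := r1le.
  have r3le' : L2dot Omega r3 r3 <= h := r3le.
  move: (L2dot Omega (fun x => _ - _) _) (L2dot Omega r1 r1) (L2dot Omega r2 r2)
    (L2dot Omega r3 r3) g2 r1le' r2h r3le' => ? ? ? ? *; lra.
have gz : c * L2dot Omega (K z) (K z) <= L2dot Omega g (K z).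
  rewrite -(L2norm_sqr Omega (K z)); apply: le_trans (cBk _ zV) _.
  rewrite [X in X <= _](Bnum_formBl Omega_bounded kp).
  rewrite (uB _ zV) (mass_formE oO Omega_bounded kp) -/(K z).
  (* Symmetry lets L^num act on K v, which approximates [u], instead of on K z. *)
  rewrite (Bnum_formC Omega_bounded kp _ _ w_sym v).
  rewrite (Bnum_form_Lnum oO Omega_bounded kp) -/(K z) -/(K v) -/Ln.
  rewrite [X in _ - X]L2dotC (L2dotNl mO (LLn (K v)) LKz) opprK.
  rewrite (L2dotBl mO Lr32 Lr1 LKz) (L2dotBl mO Lr3 Lr2 LKz).
  rewrite (L2dotBl mO (LLn u) LLu LKz) (L2dotBl mO b_L2 (LK _) LKz).
  have -> : L2dot Omega r2 (K z) =
      L2dot Omega (Ln u) (K z) - L2dot Omega (Ln (K v)) (K z).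
    rewrite -(L2dotBl mO (LLn u) (LLn (K v)) LKz); congr L2dot; apply/funext => x.
    exact: (LnumB oO Omega_bounded kp _ _ _ x Lu (LK v)).
  (* The continuous equation tested with K z, with [L] moved onto [u] by self-adjointness. *)
  have bz : L2dot Omega b (K z) = - L2dot Omega (L u) (K z).
    rewrite -(u_solution _ zV) (LB _ _ Lu LKz) L2dotC.
    by rewrite (L2dotNl mO (LL _ LKz) Lu) L2dotC (L_sa _ _ Lu LKz).
  rewrite bz; move: (L2dot Omega (L u) _) (L2dot Omega (Ln u) _)
    (L2dot Omega (Ln (K v)) _) (L2dot Omega (K (bnum kappa)) _) => *.
  by rewrite le_eqVlt; apply/orP; left; apply/eqP; ring.
have zh : L2dot Omega (K z) (K z) <= (6 + 4 * C ^+ 2) / c ^+ 2 * h.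
  have ic0 : 0 < c^-1 by rewrite invr_gt0.
  (* With the parameter c^-1, the term c |K z|^2 of Young's inequality is absorbed by [gz], which
     leaves c |K z|^2 <= c^-1 |g|^2. *)
  have := L2dot_young mO ic0 Lg LKz; rewrite invrK => gy.
  rewrite mulrAC ler_pdivlMr ?exprn_gt0// expr2 mulrA -ler_pdivlMr// mulrC.
  apply: (@le_trans _ _ (c^-1 * L2dot Omega g g)).
    by move: (L2dot Omega g g) (L2dot Omega g _) (L2dot Omega (K z) _) gz gy => *; lra.
  by rewrite [leRHS]mulrC ler_wpM2l// ltW.
rewrite ger0_norm ?sqrtr_ge0// -ler_sqr ?nnegrE ?sqrtr_ge0 ?(ltW e0)//.
rewrite L2norm_sqr.
have -> : (fun x => Kop Omega kappa (unum kappa) x - u x) =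
    (fun x => K z x + - (u x - K v x)).
  by apply/funext => x; rewrite Kz opprB addrA subrK.
apply: le_trans (L2dotD_le mO LKz (L2N mO LuKv)) _; rewrite sqN.
have -> : e ^+ 2 = 2 * ((6 + 4 * C ^+ 2) / c ^+ 2 * h) + 2 * h.
  by rewrite mulrA -mulrDl -/Q mulrC /h divfK// gt_eqF.
by rewrite lerD// ler_pM2l.
Unshelve. all: by end_near. Qed.
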